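(* There exist numerical constants $0<c_0,c_1<\infty$ and, for every $p\in\mathbb{N}$, a positive number $\ell_p\le e^{\frac52 p\log p+c_1p}$ depending only on $p$, such that the following holds. Let $p\in\mathbb{N}$, $p\ge1$, and let $\Delta$, $L_p$ and $\epsilon$ be positive. Then $$\mathcal{T}_\epsilon\big(\mathcal{A}_{\mathsf{det}},\mathcal{F}_p(\Delta,L_p)\big)\ \ge\ \mathcal{T}_\epsilon\big(\mathcal{A}_{\mathsf{zr}},\mathcal{F}_p(\Delta,L_p)\big)\ \ge\ c_0\,\Delta\left(\frac{L_p}{\ell_p}\right)^{1/p}\epsilon^{-\frac{1+p}{p}}.$$ Moreover, the lower bound $c_0\Delta(L_p/\ell_p)^{1/p}\epsilon^{-\frac{1+p}{p}}$ (on both complexities) holds even if $\mathcal{F}_p(\Delta,L_p)$ is restricted to functions whose domain $\mathbb{R}^d$ has dimension $d=\big\lceil 1+2c_0\Delta(L_p/\ell_p)^{1/p}\epsilon^{-\frac{1+p}{p}}\big\rceil$.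
   Context: $\mathbb{N}=\{1,2,\dots\}$, $[d]=\{1,\dots,d\}$, and $\|\cdot\|$ is the Euclidean norm. Function class. A function $f:\mathbb{R}^d\to\mathbb{R}$ has $L_p$-Lipschitz $p$th order derivatives if it is $p$ times continuously differentiable and for every $x\in\mathbb{R}^d$ and $v\in\mathbb{R}^d$ with $\|v\|\le1$ the function $f_{x,v}(t):=f(x+tv)$, $t\in\mathbb{R}$, satisfies $|f_{x,v}^{(p)}(t)-f_{x,v}^{(p)}(t')|\le L_p|t-t'|$ for all $t,t'\in\mathbb{R}$. $\mathcal{F}_p(\Delta,L_p)$ is the union over $d\in\mathbb{N}$ of the collection of $C^\infty$ functions $f:\mathbb{R}^d\to\mathbb{R}$ with $L_p$-Lipschitz $p$th order derivatives and $f(0)-\inf_x f(x)\le\Delta$. Algorithms. For a function $f$, let $\nabla^{(0,1,\dots)}f(x)$ denote the collection of $f(x)$ and all derivatives $\nabla f(x),\nabla^2f(x),\dots$ at $x$. A randomized algorithm $\mathsf{A}$ consists, for every dimension $d$, of measurable mappings $\mathsf{A}^{(i)}$ ($i\in\mathbb{N}$) into $\mathbb{R}^d$ (dependence on $d$ implicit); operating on $f:\mathbb{R}^d\to\mathbb{R}$ it draws $\xi\sim\mathrm{Uniform}[0,1]$ independently of $f$ and produces the iterates $\mathsf{A}[f]=\{x^{(t)}\}_{t\in\mathbb{N}}\subset\mathbb{R}^d$ given by $x^{(i)}=\mathsf{A}^{(i)}(\xi,\nabla^{(0,1,\dots)}f(x^{(1)}),\dots,\nabla^{(0,1,\dots)}f(x^{(i-1)}))$.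 $\mathcal{A}_{\mathsf{rand}}$ is the class of all randomized algorithms. $\mathcal{A}_{\mathsf{det}}$ is the class of deterministic algorithms, i.e. those for which $x^{(i)}=\mathsf{A}^{(i)}(\nabla^{(0,1,\dots)}f(x^{(1)}),\dots,\nabla^{(0,1,\dots)}f(x^{(i-1)}))$ with no dependence on $\xi$ (so $x^{(1)}$ is a fixed vector for each $d$). Zero-respecting algorithms. For $v\in\mathbb{R}^d$, $\mathrm{supp}\{v\}=\{i\in[d]: v_i\ne0\}$. For an order $k$ tensor $T$ over $\mathbb{R}^d$, let $T_i$ be the order $k-1$ tensor $[T_i]_{j_1,\dots,j_{k-1}}=T_{i,j_1,\dots,j_{k-1}}$, and $\mathrm{supp}\{T\}=\{i\in[d]: T_i\neq0\}$. A sequence $x^{(1)},x^{(2)},\dots$ in $\mathbb{R}^d$ is zero-respecting (of order $\infty$) with respect to $f:\mathbb{R}^d\to\mathbb{R}$ if $\mathrm{supp}\{x^{(t)}\}\subseteq\bigcup_{q\in\mathbb{N}}\bigcup_{s<t}\mathrm{supp}\{\nabla^q f(x^{(s)})\}$ for each $t\in\mathbb{N}$ (in particular $x^{(1)}=0$). $\mathcal{A}_{\mathsf{zr}}$ is the class of $\mathsf{A}\in\mathcal{A}_{\mathsf{rand}}$ such that for every $d$ and every $f:\mathbb{R}^d\to\mathbb{R}$ the (potentially random) sequence $\mathsf{A}[f]$ is zero-respecting with respect to $f$. Complexity. For a random process $\{x^{(t)}\}_{t\in\mathbb{N}}$ with law $P$, $\mathsf{T}_\epsilon(P,f):=\inf\{t\in\mathbb{N}\mid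 P(\|\nabla f(x^{(s)})\|>\epsilon\text{ for all }s\le t)\le\frac12\}$ (for a deterministic sequence this is $\inf\{t\in\mathbb{N}\mid\|\nabla f(x^{(t)})\|\le\epsilon\}$), and $\mathsf{T}_\epsilon(\mathsf{A},f)$ is this quantity for $\mathsf{A}[f]$. For an algorithm class $\mathcal{A}$ and function class $\mathcal{F}$, $\mathcal{T}_\epsilon(\mathcal{A},\mathcal{F}):=\inf_{\mathsf{A}\in\mathcal{A}}\sup_{f\in\mathcal{F}}\mathsf{T}_\epsilon(\mathsf{A},f)$. *)

(* Defs.v *)
From HB Require Import structures.
From mathcomp Require Import all_boot all_order all_algebra.
From mathcomp Require Import all_classical all_reals all_analysis.

Set Implicit Arguments.
Unset Strict Implicit.
Unset Printing Implicit Defensive.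
Import Order.TTheory GRing.Theory Num.Theory.
Import numFieldNormedType.Exports.
Local Open Scope classical_set_scope.
Local Open Scope ring_scope.

(* The library norm on ['rV[R]_d] is the sup norm, hence this definition. *)
Definition enorm (R : realType) (d : nat) (x : 'rV[R]_d) : R :=
  Num.sqrt (\sum_(i < d) x ord0 i ^+ 2).

Fixpoint pderiv (R : realType) (d : nat) (f : 'rV[R]_d -> R) (s : seq 'I_d) :
    'rV[R]_d -> R :=
  if s is i :: s' then fun x => 'D_(delta_mx ord0 i) (pderiv f s') x else f.

Definition contdiff (R : realType) (d k : nat) (f : 'rV[R]_d -> R) : Prop :=
  (forall s : seq 'I_d, (size s < k)%N -> forall (i : 'I_d) (x : 'rV[R]_d),
     derivable (pderiv f s) x (delta_mx ord0 i)) /\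
  (forall s : seq 'I_d, (size s <= k)%N -> continuous (pderiv f s)).

Definition smooth (R : realType) (d : nat) (f : 'rV[R]_d -> R) : Prop :=
  forall k : nat, contdiff k f.

Definition grad (R : realType) (d : nat) (f : 'rV[R]_d -> R) (x : 'rV[R]_d) :
    'rV[R]_d :=
  \row_i pderiv f [:: i] x.

(* Order-[q] tensors are given by their entries. *)
Definition tensor (R : realType) (d q : nat) : Type := q.-tuple 'I_d -> R.

Definition slice (R : realType) (d q : nat) (T : tensor R d q.+1) (i : 'I_d) :
    tensor R d q :=
  fun s => T [tuple of i :: s].

Definition nabla (R : realType) (d q : nat) (f : 'rV[R]_d -> R)
    (x : 'rV[R]_d) : tensor R d q :=
  fun s => pderiv f s x.
Arguments nabla {R d} q f x _.

Definition vsupp (R : realType) (d : nat) (v : 'rV[R]_d) : set 'I_d :=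
  [set i | v ord0 i <> 0].

Definition tsupp (R : realType) (d q : nat) (T : tensor R d q.+1) : set 'I_d :=
  [set i | slice T i <> (fun=> 0)].

Definition lipschitz_deriv (R : realType) (d p : nat) (L : R)
    (f : 'rV[R]_d -> R) : Prop :=
  contdiff p f /\
  forall x v : 'rV[R]_d, enorm v <= 1 ->
  forall t t' : R,
    let fxv : R -> R := fun u => f (x + u *: v) in
    `|(fxv^`(p))%classic t - (fxv^`(p))%classic t'| <= L * `|t - t'|.

(* A function class is a union over all dimensions, i.e. a family indexed by
   the dimension [d]. *)
Definition fclass (R : realType) : Type :=
  forall d : nat, set ('rV[R]_d -> R).

(* The infimum is taken in the extended reals: it is [-oo] if [f] is unbounded
   below, and then the last condition fails. *)
Definition Fclass (R : realType) (p : nat) (Delta L : R) : fclass R :=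
  fun d => [set f | [/\ (0 < d)%N, smooth f, lipschitz_deriv p L f &
    ((f 0)%:E - ereal_inf (range (fun x => (f x)%:E)) <= Delta%:E)%E]].

Definition restrict_dim (R : realType) (F : fclass R) (d0 : nat) : fclass R :=
  fun d => [set f | d = d0 /\ F d f].

(* The values at a point of a function and of all its partial derivatives: the
   entries of the order-[q] derivative are those with index of size [q]. *)
Definition jet (R : realType) (d : nat) : Type := seq 'I_d -> R.

Definition jet_at (R : realType) (d : nat) (f : 'rV[R]_d -> R)
    (x : 'rV[R]_d) : jet R d :=
  fun s => pderiv f s x.

(* Generators of the smallest sigma-algebra on [T] making all the real-valued
   coordinates [coord i] Borel measurable, i.e. of the product sigma-algebra. *)
Definition cylinders (R : realType) (T I : Type) (coord : I -> T -> R) :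
    set (set T) :=
  \bigcup_(i in [set: I]) preimage_set_system [set: T] (coord i) measurable.

Definition meas_jet (R : realType) (d : nat) :=
  g_sigma_algebraType (cylinders (fun (s : seq 'I_d) (j : jet R d) => j s)).

Definition meas_rV (R : realType) (d : nat) :=
  g_sigma_algebraType
    (cylinders (fun (j : 'I_d) (x : 'rV[R]_d) => x ord0 j)).

(* Iterates are numbered from 0: [alg_map d i] produces the [(i+1)]-st iterate
   in dimension [d] from the random seed in [[0, 1]] and the [i] previous
   oracle answers, oldest first. *)
Record rand_alg (R : realType) : Type := RandAlg {
  alg_map : forall d i : nat, R * i.-tuple (jet R d) -> 'rV[R]_d ;
  alg_meas : forall d i : nat,
    measurable_fun ([set xi : measurableTypeR R | xi \in `[0, 1]] `*`
                    [set: i.-tuple (meas_jet R d)])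
      (@alg_map d i : measurableTypeR R * i.-tuple (meas_jet R d) ->
                     meas_rV R d)
}.

Fixpoint history (R : realType) (A : rand_alg R) (d : nat)
    (f : 'rV[R]_d -> R) (xi : R) (i : nat) : i.-tuple (jet R d) :=
  if i is i'.+1 then
    let h := history A f xi i' in
    [tuple of rcons h (jet_at f (alg_map A (xi, h)))]
  else [tuple].

Definition iterate (R : realType) (A : rand_alg R) (d : nat)
    (f : 'rV[R]_d -> R) (t : nat) (xi : R) : 'rV[R]_d :=
  alg_map A (xi, history A f xi t).

Definition zero_respecting (R : realType) (d : nat) (f : 'rV[R]_d -> R)
    (x : nat -> 'rV[R]_d) : Prop :=
  forall t : nat,
    vsupp (x t) `<=`
    \bigcup_(q in [set: nat])
    \bigcup_(s in [set s : nat | (s < t)%N]) tsupp (nabla q.+1 f (x s)).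

Definition A_rand (R : realType) : set (rand_alg R) := [set: rand_alg R].

Definition A_det (R : realType) : set (rand_alg R) :=
  [set A | A_rand A /\ forall (d i : nat) (xi xi' : R) (h : i.-tuple (jet R d)),
     xi \in `[0, 1] -> xi' \in `[0, 1] ->
     alg_map A (xi, h) = alg_map A (xi', h)].

(* The derivatives fed to the algorithm only make sense for [f] having
   derivatives of all orders. *)
Definition A_zr (R : realType) : set (rand_alg R) :=
  [set A | A_rand A /\ forall (d : nat) (f : 'rV[R]_d -> R), smooth f ->
     forall xi : R, xi \in `[0, 1] ->
     zero_respecting f (fun t => iterate A f t xi)].

(* As the process is numbered from 0, its first [t] elements are the [X s] for
   [s < t]. *)
Definition process_time (R : realType) (d : nat) (disp : measure_display)
    (Omega : measurableType disp) (P : probability Omega R)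
    (X : nat -> Omega -> 'rV[R]_d) (eps : R) (f : 'rV[R]_d -> R) : \bar R :=
  ereal_inf [set (t%:R)%:E | t in [set t : nat | (0 < t)%N /\
    (P [set w | forall s : nat, (s < t)%N -> (eps < enorm (grad f (X s w)))%R]
       <= (2^-1)%:E)%E]].

Definition alg_time (R : realType) (A : rand_alg R) (eps : R) (d : nat)
    (f : 'rV[R]_d -> R) : \bar R :=
  process_time (uniform_prob (@ltr01 R)) (iterate A f) eps f.

Definition complexity (R : realType) (eps : R) (CA : set (rand_alg R))
    (F : fclass R) : \bar R :=
  ereal_inf [set ereal_sup [set u | exists (d : nat) (f : 'rV[R]_d -> R),
                               F d f /\ u = alg_time A eps f]
            | A in CA].

Definition lower_bound (R : realType) (c0 lp : R) (p : nat)
    (Delta L eps : R) : R :=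
  c0 * Delta * (L / lp) `^ (p%:R^-1) * eps `^ (- ((1 + p%:R) / p%:R)).

(* Main.v *)
(* The hard instance is a chain [sum_(i < T) (psi (- y_(i-1)) psi (2 - y_i)
   - psi (y_(i-1)) psi (2 + y_i))] with [y_(-1) = 1] and [psi x = exp (-1/x)]
   for [x > 0]. As [psi] is flat at [0], a zero-respecting sequence
   discovers at most one coordinate per query; as long as the last coordinate is
   [0] there is a first [i] with [|y_i| < 1], and there [|y_(i-1)| >= 1], so the
   [i]-th partial derivative is bounded away from [0]. The [n]-th derivative of
   [psi] is at most [2^n (2n)!], which gives the constant [ell p], and scaling
   gives the bound.

   A deterministic algorithm is reduced to a zero-respecting one by a resisting
   oracle: run it on [y |-> f (y *m W^T)], choosing the orthonormal rows of [W]
   one at a time, when the corresponding coordinate is first seen in a derivative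
   of [f], orthogonally to all previous queries. The queries multiplied by
   [W^T] are then a zero-respecting sequence for [f]. *)
Require Import Defs.
From mathcomp Require Import all_boot all_order all_algebra.
From mathcomp Require Import all_classical all_reals all_analysis.
From mathcomp Require Import measurable_realfun ring lra zify.
Import Order.TTheory GRing.Theory Num.Theory.
Import numFieldNormedType.Exports.
Local Open Scope classical_set_scope.
Local Open Scope ring_scope.

Set Implicit Arguments.
Unset Strict Implicit.
Unset Printing Implicit Defensive.

(** * Flat functions *)

Section flat.
Context {R : realType}.
Implicit Types (x : R) (j n : nat).

(** The two products of a link are mirror images, one for each sign of y_(i-1); as they enter the
    chain, both are nonincreasing in each coordinate, so contributions to a partial derivative never
    cancel. A link involves only two coordinates, which keeps the Lipschitz constant independent of
    the dimension.

    Algorithms are measurable maps, so the resisting oracle may not pick its rows by choice: they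
    are computed by a formula. It must also fix the dimension of the simulated run before seeing
    [f]. Every row and every query takes up one dimension, and the number of queries to resist is
    bounded by the worst-case time of the deterministic algorithm, the comparison being trivial when
    that time is infinite. In a prescribed dimension the deterministic bound does not follow from
    the comparison, as lifting changes the dimension; instead a chain in T + 1 variables is hidden
    from T queries, which takes 2 T + 1 dimensions and explains 1 + 2 B. *)

Lemma cvg_is_derive (V W : normedModType R) (f : V -> W) (a v : V) (l : W) :
  (fun h => h^-1 *: (f (h *: v + a) - f a)) @ 0^' --> l -> is_derive a v f l.
Proof. by move=> fl; apply: DeriveDef; [exact: (cvgP l) | exact: cvg_lim]. Qed.

Lemma is_derive_cvg (V W : normedModType R) (f : V -> W) (a v : V) (l : W) :
  is_derive a v f l -> (fun h => h^-1 *: (f (h *: v + a) - f a)) @ 0^' --> l.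
Proof. by move=> [d <-]. Qed.

(** [psi] is [flat 0]; the powers of 1/x close the family under differentiation, up to linear
    combinations. *)
Definition flat j x : R := if 0 < x then x^-1 ^+ j * expR (- x^-1) else 0.

Lemma flat_ge0 j x : 0 <= flat j x.
Proof.
rewrite /flat; case: ifP => // x0.
by rewrite mulr_ge0 ?expR_ge0// exprn_ge0// invr_ge0 ltW.
Qed.

Lemma flat_le0 j x : x <= 0 -> flat j x = 0.
Proof. by rewrite /flat leNgt => /negbTE ->. Qed.

(** For u = 1/x, u^j / j! is one term of the series of exp u. *)
Lemma flat_ub j x : flat j x <= j`!%:R.
Proof.
rewrite /flat; case: ifP => // x0.
rewrite expRN ler_pdivrMr ?expR_gt0//.
have u0 : 0 <= x^-1 by rewrite invr_ge0 ltW.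
have f0 : (0 : R) < j`!%:R by rewrite ltr0n fact_gt0.
rewrite mulrC -ler_pdivrMr//; case: j f0 => [|j] f0.
  by rewrite expr0 fact0 divr1; apply: le_trans _ (expR_ge1Dx _); rewrite lerDl.
by apply: le_trans _ (expR_ge1Dxn j u0); rewrite lerDr.
Qed.

(** Makes the difference quotients at [0] tend to 0: x^(-j) = x^(-j-2) x^2, and [flat j.+2] is
    bounded. *)
Lemma flat_quadratic j x : `|flat j x| <= (j.+2)`!%:R * x ^+ 2.
Proof.
rewrite ger0_norm ?flat_ge0//; have [x0|x0] := ltP 0 x; last first.
  by rewrite flat_le0// mulr_ge0 ?sqr_ge0.
have -> : flat j x = flat j.+2 x * x ^+ 2.
  rewrite /flat x0 -(addn2 j) exprD mulrAC -[X in _ = X * _]mulrA -exprMn.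
  by rewrite mulVf ?gt_eqF// expr1n mulr1.
by rewrite ler_wpM2r ?sqr_ge0// flat_ub.
Qed.

Lemma is_derive_flat j x :
  is_derive x 1 (flat j) (flat j.+2 x - j%:R * flat j.+1 x).
Proof.
have [x0|x0|->] := ltgtP x 0.
- rewrite !flat_le0 ?(ltW x0)// mulr0 subr0.
  apply: (@near_eq_is_derive R R R (cst 0)).
  near=> y; rewrite /= flat_le0//; near: y.
  by apply: filterS (lt_nbhsl x0) => ? /ltW.
- apply: (@near_eq_is_derive R R R (fun y => y^-1 ^+ j * expR (- y^-1))).
  + near=> y; rewrite /flat ifT//; near: y; exact: lt_nbhsr.
  + have xn0 : x != 0 by rewrite gt_eqF.
    have dV : is_derive x 1 (fun y : R => y^-1) (- x^-1 ^+ 2).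
      apply: DeriveDef; first exact: derivableV.
      by rewrite deriveV// derive_id [_ *: _]mulr1 exprVn.
    have dE : is_derive x 1 (expR \o (fun y => - y^-1)) (expR (- x^-1) * x^-1 ^+ 2).
      by apply: is_derive_eq; rewrite opprK mulrC.
    have dX := is_deriveX j dV.
    rewrite [X in is_derive _ _ X _](_ : _ =
       (fun y : R => y^-1) ^+ j * (expR \o (fun y => - y^-1))); last first.
      by apply/funext => y; rewrite /GRing.mul/= exprfctE.
    apply: is_derive_eq; rewrite /flat x0 /= exprfctE.
    by case: j dX => [|j] _; rewrite /GRing.scale/= ?exprS; ring.
- rewrite !flat_le0// mulr0 subr0; apply: cvg_is_derive.
  have h0 : (fun h : R => (j.+2)`!%:R * `|h|) @ 0^' --> (0 : R).
    rewrite -{2}(mulr0 ((j.+2)`!%:R)); apply: cvgMr.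
    rewrite -{2}(@normr0 _ R); apply: cvg_norm.
    by apply: cvg_within_filter; exact: cvg_id.
  apply: norm_cvg0.
  apply: (@squeeze_cvgr _ _ _ _ (cst 0) (fun h : R => (j.+2)`!%:R * `|h|)) => //;
    last exact: cvg_cst.
  near=> h; rewrite normr_ge0/= [h *: _]mulr1 addr0 (@flat_le0 _ 0)// subr0.
  rewrite normrM normfV.
  have hn0 : h != 0 by near: h; exact: nbhs_dnbhs_neq.
  rewrite ler_pdivrMl ?normr_gt0//.
  apply: le_trans (flat_quadratic j h) _.
  by rewrite [leRHS]mulrCA -[in leRHS]expr2 real_normK ?num_real.
Unshelve. all: by end_near. Qed.

(** The [n]-th derivative of [flat j]: one derivative is expanded and the others are taken of its
    two terms, so that bounds follow by induction on [n] for all [j]. *)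
Fixpoint flatn n j x : R :=
  if n is n'.+1 then flatn n' j.+2 x - j%:R * flatn n' j.+1 x else flat j x.

Lemma is_derive_flatn n j x : is_derive x 1 (flatn n j) (flatn n.+1 j x).
Proof.
elim: n j => [|n IH] j; first exact: is_derive_flat.
have d1 := IH j.+2; have d2 := IH j.+1.
have := is_deriveB d1 (is_deriveZ j%:R d2).
exact.
Qed.

Lemma flatn_le0 n j x : x <= 0 -> flatn n j x = 0.
Proof.
move=> x0; elim: n j => [|n IH] j /=; first exact: flat_le0.
by rewrite !IH mulr0 subr0.
Qed.

(** Both terms of the recursion are at most 2^n (j + 2n + 2)!, the second because j (j + 2n + 1)! <=
    (j + 2n + 2)!. *)
Lemma flatn_bound n j x : `|flatn n j x| <= 2 ^+ n * (j + 2 * n)`!%:R.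
Proof.
elim: n j => [|n IH] j /=.
  by rewrite muln0 addn0 mul1r ger0_norm ?flat_ge0 ?flat_ub.
apply: le_trans (ler_normB _ _) _.
rewrite exprS -(mulrA 2) (mulr_natl _ 2) mulr2n lerD//.
  apply: le_trans (IH _) _; rewrite ler_pM2l ?exprn_gt0// ler_nat.
  by rewrite mulnS !addnA addn2.
rewrite normrM [`|j%:R|]ger0_norm ?ler0n//.
apply: le_trans (ler_wpM2l _ (IH _)) _ => //.
rewrite mulrCA ler_pM2l ?exprn_gt0// -natrM ler_nat.
rewrite mulnS addnCA !addSn add0n addnA factS leq_mul//.
by rewrite -addnA leqW// leqW// leq_addr.
Qed.

End flat.

(** * Calculus of several variables *)

Section directional.
Context {R : realType} {V : normedModType R}.
Implicit Types (f g : V -> R) (x u v w : V).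

Lemma MVT_global (f df : R -> R) (a b : R) :
  (forall x : R, is_derive x 1 f (df x)) ->
  exists2 c, `|c - a| <= `|b - a| & f b - f a = df c * (b - a).
Proof.
move=> fdf; have cf : continuous f.
  move=> x; apply/differentiable_continuous/derivable1_diffP.
  by have [] := fdf x.
have [ab|ba] := leP a b.
  have [] := @MVT_segment _ f df a b ab (fun (x : R) _ => fdf x).
    exact: continuous_subspaceT.
  move=> c; rewrite in_itv/= => /andP[ac cb] E; exists c => //.
  by rewrite !ger0_norm ?subr_ge0// lerD2r.
have [] := @MVT_segment _ f df b a (ltW ba) (fun (x : R) _ => fdf x).
  exact: continuous_subspaceT.
move=> c; rewrite in_itv/= => /andP[bc ca] E; exists c => //.
  by rewrite distrC (distrC b) !ger0_norm ?subr_ge0 ?(ltW ba)// lerD2l lerN2.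
by rewrite -opprB E -mulrN opprB.
Qed.

Lemma is_derive_line f x v (t d : R) :
  is_derive (x + t *: v) v f d -> is_derive t 1 (fun s => f (x + s *: v)) d.
Proof.
move=> /is_derive_cvg df; apply: cvg_is_derive; apply: cvg_trans df.
apply: near_eq_cvg; near=> h.
by rewrite [h%:A]mulr1 [(h + t) *: v]scalerDl addrCA.
Unshelve. all: by end_near. Qed.

Lemma continuous_plane (F : V -> R) x u v (e : R) :
  {for x, continuous F} -> 0 < e ->
  exists2 h : R, 0 < h & forall b c : R, `|b| <= h -> `|c| <= h ->
    `|F x - F (x + b *: u + c *: v)| < e.
Proof.
move=> /cvgrPdist_lt cF e0; have /nbhs_ballP[d /= d0 dF] := cF _ e0.
have K0 : 0 < `|u| + `|v| + 1 by rewrite ltr_wpDl// addr_ge0.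
exists (d / (`|u| + `|v| + 1)); first by rewrite divr_gt0.
move=> b c hb hc; apply: dF; rewrite -ball_normE/=.
rewrite -addrA opprD addrA subrr sub0r normrN.
apply: le_lt_trans (ler_normD _ _) _; rewrite !normrZ.
have /le_lt_trans : `|b| * `|u| + `|c| * `|v| <= d / (`|u| + `|v| + 1) * (`|u| + `|v|).
  by rewrite mulrDr lerD// ler_wpM2r.
apply; rewrite mulrAC ltr_pdivrMr// ltr_pM2l// ltrDl//.
Qed.

(** An increment along [w + v] is one along [w] followed by one along [v]; the mean value theorem
    turns the latter into a value of ['D_v f] near [x], where continuity applies. *)
Lemma is_derive_addv f x w v (d : R) : is_derive x w f d ->
  (forall y, derivable f y v) -> {for x, continuous ('D_v f)} ->
  is_derive x (w + v) f (d + 'D_v f x).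
Proof.
move=> /is_derive_cvg fw fv cD; apply: cvg_is_derive.
have -> : (fun h : R => h^-1 *: (f (h *: (w + v) + x) - f x)) =
   (fun h : R => h^-1 *: (f (h *: w + x) - f x)) +
   (fun h : R => h^-1 *: (f (h *: (w + v) + x) - f (h *: w + x))).
  by apply/funext => h; rewrite -[RHS]scalerDr; congr (_ *: _); ring.
apply: cvgD fw _; apply/cvgrPdist_lt => e e0.
have [r r0 hr] := continuous_plane w v cD e0.
near=> h.
have hn0 : h != 0 by near: h; exact: nbhs_dnbhs_neq.
have hlt : `|h| <= r by apply: ltW; near: h; exact: dnbhs0_lt.
have [|c cb] := @MVT_global (fun s => f (x + h *: w + s *: v))
   (fun s => 'D_v f (x + h *: w + s *: v)) 0 h.
  by move=> s; apply: is_derive_line; exact/derivableP.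
rewrite !subr0 scale0r addr0 in cb * => E.
rewrite (scalerDr h w v) (addrC _ x) (addrC _ x) addrA E /GRing.scale/= mulrCA.
rewrite mulVf// mulr1.
by apply: hr => //; exact: le_trans cb hlt.
Unshelve. all: by end_near. Qed.

Lemma is_deriveZv f x v (c d : R) : is_derive x v f d ->
  is_derive x (c *: v) f (c * d).
Proof.
move=> fd; have fd' : is_derive (c * 0 : R) 1 (fun s => f (x + s *: v)) d.
  by apply: is_derive_line; rewrite mulr0 scale0r addr0.
have cd : is_derive (0 : R) 1 (fun s : R => c * s) c.
  have := is_deriveZ c (is_derive_id (0 : R) 1).
  by rewrite [c *: _]mulr1.
have := is_derive1_comp fd' cd; rewrite mulrC => /is_derive_cvg H.
apply: cvg_is_derive; apply: cvg_trans H; apply: near_eq_cvg; near=> h => /=.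
by rewrite !addr0 [h%:A]mulr1 mulr0 scale0r addr0 (scalerA h c v) (mulrC h) (addrC x).
Unshelve. all: by end_near. Qed.

(** Schwarz's theorem. The second difference of [g] over the parallelogram with sides h u and h v is
    symmetric in [u] and [v], and two mean value theorems equate it to h^2 times either mixed
    derivative at a point close to [x]. *)
Lemma derive_comm g u v x :
  (forall y, derivable g y u) -> (forall y, derivable g y v) ->
  (forall y, derivable ('D_u g) y v) -> (forall y, derivable ('D_v g) y u) ->
  {for x, continuous ('D_v ('D_u g))} -> {for x, continuous ('D_u ('D_v g))} ->
  'D_v ('D_u g) x = 'D_u ('D_v g) x.
Proof.
have mixed (a b : V) (h : R) : (forall y, derivable g y a) ->
    (forall y, derivable ('D_a g) y b) -> exists c c' : R,
    [/\ `|c| <= `|h|, `|c'| <= `|h| &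
     g (x + h *: a + h *: b) - g (x + h *: a) - g (x + h *: b) + g x =
     'D_b ('D_a g) (x + c *: a + c' *: b) * h * h].
  move=> da dab.
  have [|c cb] := @MVT_global (fun s => g (x + h *: b + s *: a) - g (x + s *: a))
    (fun s => 'D_a g (x + h *: b + s *: a) - 'D_a g (x + s *: a)) 0 h.
    by move=> s; apply: is_deriveB; apply: is_derive_line; exact/derivableP.
  rewrite !subr0 in cb *; rewrite !scale0r !addr0 => E1.
  have [|c' c'b] := @MVT_global (fun s => 'D_a g (x + c *: a + s *: b))
    (fun s => 'D_b ('D_a g) (x + c *: a + s *: b)) 0 h.
    by move=> s; apply: (@is_derive_line ('D_a g)); exact/derivableP.
  rewrite !subr0 in c'b *; rewrite !scale0r !addr0 => E2.
  exists c, c'; split=> //; rewrite -E2.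
  rewrite (addrAC x (c *: a)) -E1 (addrAC x (h *: b)); ring.
move=> du dv duv dvu cuv cvu; apply/eqP; rewrite -subr_eq0 -normr_eq0.
apply/negPn/negP => ne.
set e := `|_| in ne; have e0 : 0 < e by rewrite lt_neqAle eq_sym ne normr_ge0.
have e20 : 0 < e / 2 by rewrite divr_gt0.
have [h1 h10 H1] := continuous_plane u v cuv e20.
have [h2 h20 H2] := continuous_plane v u cvu e20.
set h : R := Num.min h1 h2; have h0 : 0 < h by rewrite lt_min h10.
have [b [b' [bh b'h Eb]]] := mixed u v h du duv.
have [c [c' [ch c'h Ec]]] := mixed v u h dv dvu.
have h12 (z : R) : `|z| <= h -> `|z| <= h1 /\ `|z| <= h2.
  by rewrite le_min => /andP.
rewrite (gtr0_norm h0) in bh b'h ch c'h.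
have := H1 b b' (h12 _ bh).1 (h12 _ b'h).1.
have := H2 c c' (h12 _ ch).2 (h12 _ c'h).2.
have -> : 'D_u ('D_v g) (x + c *: v + c' *: u) =
          'D_v ('D_u g) (x + b *: u + b' *: v).
  have hn0 : h != 0 by rewrite gt_eqF.
  have cancel (P Q : R) : P * h * h = Q * h * h -> P = Q.
    by move=> /(mulIf hn0)/(mulIf hn0).
  apply: cancel; apply: etrans (esym Ec) (etrans _ Eb).
  by rewrite (addrAC x (h *: u)); congr (_ + _); exact: addrAC.
set A := 'D_v ('D_u g) x; set B := 'D_u ('D_v g) x; set C := 'D_v _ _.
move=> BC AC; suff : e < e by rewrite ltxx.
rewrite {1}/e -(subrKA C) [ltRHS]splitr.
apply: le_lt_trans (ler_normD _ _) _.
apply: ltrD; first exact: AC.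
by rewrite distrC; exact: BC.
Qed.

End directional.

Lemma continuous_scale (R : realType) (T : topologicalType) (c : R) (F : T -> R) :
  continuous F -> continuous (fun z => c * F z).
Proof. move=> cF z; exact: (cvgMl_tmp (cF z)). Qed.

Lemma is_derive_coord (R : realType) (d : nat) (f : 'rV[R]_d -> R) (x v : 'rV[R]_d) :
  (forall i y, derivable f y (delta_mx ord0 i)) ->
  (forall i, continuous ('D_(delta_mx ord0 i) f)) ->
  is_derive x v f (\sum_(i < d) v ord0 i * 'D_(delta_mx ord0 i) f x).
Proof.
move=> df cf; rewrite [X in is_derive _ X _ _](row_sum_delta v).
elim: (index_enum _) => [|i s IH]; first by rewrite !big_nil; exact: is_derive0.
rewrite !big_cons addrC [X in is_derive _ _ _ X]addrC.
have dv y : is_derive y (v ord0 i *: delta_mx ord0 i) f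
    (v ord0 i * 'D_(delta_mx ord0 i) f y).
  by apply: is_deriveZv; exact/derivableP.
have -> : v ord0 i * 'D_(delta_mx ord0 i) f x =
    'D_(v ord0 i *: delta_mx ord0 i) f x by rewrite [RHS]derive_val.
apply: is_derive_addv => //.
have -> : 'D_(v ord0 i *: delta_mx ord0 i) f =
    (fun y => v ord0 i * 'D_(delta_mx ord0 i) f y).
  by apply/funext => y; rewrite derive_val.
exact: continuous_scale (cf i) x.
Qed.

Section smooth.
Context {R : realType} {d : nat}.
Implicit Types (f : 'rV[R]_d -> R) (x v : 'rV[R]_d) (s : seq 'I_d).

Lemma smoothP f : smooth f <->
  (forall s i x, derivable (pderiv f s) x (delta_mx ord0 i)) /\
  (forall s, continuous (pderiv f s)).
Proof.
split=> [sf|[df cf] k]; last by split=> [s _ i x|s _]; [exact: df|exact: cf].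
by split=> [s i x|s]; have [H1 H2] := sf (size s).+1; [exact: H1|exact: H2].
Qed.

Lemma smooth_derivable f s i x : smooth f ->
  derivable (pderiv f s) x (delta_mx ord0 i).
Proof. by move=> /smoothP[+ _]; exact. Qed.

Lemma smooth_continuous f s : smooth f -> continuous (pderiv f s).
Proof. by move=> /smoothP[_]; exact. Qed.

Lemma is_derive_pderiv f s x v : smooth f ->
  is_derive x v (pderiv f s) (\sum_(i < d) v ord0 i * pderiv f (i :: s) x).
Proof.
move=> sf; apply: is_derive_coord => [i y|i]; first exact: smooth_derivable.
exact: (@smooth_continuous f (i :: s)).
Qed.

(** By symmetry of derivatives. Supports are read off the first index only, whereas a coordinate may
    occur anywhere in a multi-index. *)
Lemma pderiv_mem f s i : smooth f -> i \in s ->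
  exists t, pderiv f s = pderiv f (i :: t).
Proof.
move=> sf; elim: s => // k s IH; rewrite inE => /predU1P[->|/IH[t E]].
  by exists s.
exists (k :: t); apply/funext => x; rewrite /= E /=.
apply: derive_comm => [y|y|y|y||].
- exact: smooth_derivable.
- exact: smooth_derivable.
- exact: (@smooth_derivable f (i :: t)).
- exact: (@smooth_derivable f (k :: t)).
- exact: (@smooth_continuous f [:: k, i & t]).
- exact: (@smooth_continuous f [:: i, k & t]).
Qed.

End smooth.

(** The jet of [f (y *m U)] computed from the jet of [f] at [y *m U] alone, so that an algorithm
    knowing only the answers about [f] can produce it. *)
Fixpoint push_jet {R : realType} {m n : nat} (U : 'M[R]_(m, n)) (j : jet R n)
    (s : seq 'I_m) : R :=
  if s is i :: s' then \sum_(k < n) U i k * push_jet U (fun t => j (k :: t)) s'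
  else j [::].

Section push_jet.
Context {R : realType} {m n : nat}.
Implicit Types (U : 'M[R]_(m, n)) (f : 'rV[R]_n -> R).

(** Column [k] of [U] multiplies only entries of [j] with [k] in their index. Hence rows of [W]
    chosen later leave earlier answers unchanged. *)
Lemma eq_push_jet_on (D : {set 'I_n}) U U' (j : jet R n) (s : seq 'I_m) :
  (forall i k, k \in D -> U i k = U' i k) ->
  (forall t k, k \in t -> k \notin D -> j t = 0) ->
  push_jet U j s = push_jet U' j s.
Proof.
move=> UU'; elim: s j => //= i s IH j j0; apply: eq_bigr => k _.
have [kD|kD] := boolP (k \in D).
  rewrite UU'// (IH (fun t => j (k :: t)))// => t l lt lD.
  by apply: (j0 _ l) => //; rewrite inE lt orbT.
suff pj0 (W : 'M[R]_(m, n)) (q : jet R n) : (forall t, q t = 0) ->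
    forall s', push_jet W q s' = 0.
  by rewrite !pj0 ?mulr0// => t; apply: (j0 _ k) => //; rewrite inE eqxx.
move=> q0 s'; elim: s' q q0 => //= i' s' IH' q q0.
by rewrite big1// => l _; rewrite IH' ?mulr0.
Qed.

Lemma is_derive_mulmx U f (y v : 'rV[R]_m) (d : R) :
  is_derive (y *m U) (v *m U) f d -> is_derive y v (fun z => f (z *m U)) d.
Proof.
move=> /is_derive_cvg df; apply: cvg_is_derive; apply: cvg_trans df.
by apply: near_eq_cvg; near=> h; rewrite mulmxDl scalemxAl.
Unshelve. all: by end_near. Qed.

Lemma continuous_mulmx U : continuous (fun y : 'rV[R]_m => y *m U).
Proof.
rewrite (_ : mulmx^~ U = fun y => \sum_i y ord0 i *: row i U); last first.
  by apply/funext => y; rewrite mulmx_sum_row.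
apply: continuous_big => [|i _ y]; first exact: add_continuous.
exact: (cvgZ (@coord_continuous R 1 m ord0 i y) (cvg_cst (row i U))).
Qed.

Lemma is_derive_push_jet U (J : 'rV[R]_n -> jet R n)
    (dJ : 'rV[R]_n -> jet R n) (s : seq 'I_m) (x v : 'rV[R]_n) :
  (forall t, is_derive x v (J ^~ t) (dJ x t)) ->
  is_derive x v (fun z => push_jet U (J z) s) (push_jet U (dJ x) s).
Proof.
elim: s J dJ => [|i s IH] J dJ dH /=; first exact: dH.
have := @is_derive_sum _ _ _ n (fun k z => U i k * push_jet U (fun t => J z (k :: t)) s)
  x v (fun k => U i k * push_jet U (fun t => dJ x (k :: t)) s).
rewrite (_ : \sum_(_ < _) _ = fun z => \sum_(k < n) U i k * push_jet U (fun t => J z (k :: t)) s).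
  apply => k; apply: is_deriveZ; exact: (IH (fun z t => J z (k :: t)) (fun z t => dJ z (k :: t))).
by apply/funext => z; rewrite fct_sumE.
Qed.

Lemma continuous_push_jet U (J : 'rV[R]_n -> jet R n) (s : seq 'I_m) :
  (forall t, continuous (J ^~ t)) -> continuous (fun z => push_jet U (J z) s).
Proof.
elim: s J => [|i s IH] J cJ /=; first exact: cJ.
apply: continuous_big => [|k _]; first exact: add_continuous.
by apply: (continuous_scale (F := fun z => push_jet U (fun t => J z (k :: t)) s)); exact: IH.
Qed.

Lemma push_jet_sum U (c : 'I_n -> R) (J : 'I_n -> jet R n) (s : seq 'I_m) :
  push_jet U (fun t => \sum_(k < n) c k * J k t) s =
  \sum_(k < n) c k * push_jet U (J k) s.
Proof.
elim: s J => //= i s IH J.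
rewrite (eq_bigr (fun l => \sum_k c k * (U i l * push_jet U (fun t => J k (l :: t)) s))).
  by rewrite exchange_big; apply: eq_bigr => k _; rewrite mulr_sumr.
by move=> l _; rewrite IH mulr_sumr; apply: eq_bigr => k _; rewrite mulrCA.
Qed.

Lemma pderiv_mulmx U f (s : seq 'I_m) : smooth f ->
  pderiv (fun y => f (y *m U)) s = fun y => push_jet U (jet_at f (y *m U)) s.
Proof.
move=> sf; elim: s => //= i s ->; apply/funext => y; apply: derive_val.
apply: (@is_derive_mulmx U (fun z => push_jet U (jet_at f z) s)).
have <- : push_jet U (fun t => \sum_(k < n) U i k * pderiv f (k :: t) (y *m U)) s =
    \sum_(k < n) U i k * push_jet U (fun t => jet_at f (y *m U) (k :: t)) s.
  move: (y *m U) => z; exact: push_jet_sum.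
apply: (@is_derive_push_jet U (jet_at f)
  (fun z t => \sum_(k < n) U i k * pderiv f (k :: t) z)) => t.
rewrite -rowE.
have := is_derive_pderiv t (y *m U) (row i U) sf.
by under eq_bigr do rewrite mxE.
Qed.

Lemma smooth_mulmx U f : smooth f -> smooth (fun y => f (y *m U)).
Proof.
move=> sf; apply/smoothP; split=> [s i x|s]; rewrite pderiv_mulmx//.
  have H := @is_derive_mulmx U (fun z => push_jet U (jet_at f z) s).
  suff [d Hd] : exists d, is_derive (x *m U) (delta_mx ord0 i *m U)
      (fun z => push_jet U (jet_at f z) s) d by have [] := H _ _ _ Hd.
  pose u : 'rV[R]_n := delta_mx ord0 i *m U.
  pose J z (t : seq 'I_n) := \sum_(k < n) u ord0 k * pderiv f (k :: t) z.
  exists (push_jet U (J (x *m U)) s).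
  apply: (@is_derive_push_jet U (jet_at f) J) => t.
  exact: is_derive_pderiv.
move=> y; apply: (@continuous_comp 'rV[R]_m 'rV[R]_n R (fun y => y *m U)
  (fun z => push_jet U (jet_at f z) s)).
  exact: continuous_mulmx.
by apply: continuous_push_jet => t; exact: smooth_continuous.
Qed.

End push_jet.

(** * The resisting oracle *)

Section fresh.
Context {R : realType} {d : nat}.
Implicit Types (u v w x : 'rV[R]_d) (P : 'M[R]_d) (s : seq 'rV[R]_d).

Definition dot u v : R := (u *m v^T) ord0 ord0.

Lemma dotE u v : dot u v = \sum_(i < d) u ord0 i * v ord0 i.
Proof. by rewrite /dot mxE; apply: eq_bigr => i _; rewrite mxE. Qed.

Lemma dotC u v : dot u v = dot v u.
Proof. by rewrite !dotE; apply: eq_bigr => i _; rewrite mulrC. Qed.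

Lemma dot0v u : dot 0 u = 0.
Proof. by rewrite /dot mul0mx mxE. Qed.

Lemma dotZl (c : R) u v : dot (c *: u) v = c * dot u v.
Proof. by rewrite /dot -scalemxAl mxE. Qed.

Lemma mulmx_dot u v : u *m v^T = (dot u v)%:M.
Proof. by rewrite [LHS]mx11_scalar. Qed.

Lemma dotvv_ge0 u : 0 <= dot u u.
Proof. by rewrite dotE sumr_ge0// => i _; rewrite -expr2 sqr_ge0. Qed.

Lemma dotvv_eq0 u : (dot u u == 0) = (u == 0).
Proof.
apply/idP/idP => [|/eqP->]; last by rewrite dot0v.
rewrite dotE psumr_eq0; last by move=> i _; rewrite -expr2 sqr_ge0.
move=> /allP u0; apply/eqP/rowP => i; rewrite mxE.
by have := u0 i (mem_index_enum _); rewrite mulf_eq0 orbb => /eqP.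
Qed.

(* Shrinks the range of the orthogonal projector [P] to the orthogonal of [v].
   If [v *m P = 0] then [deflate P v = P], because [0^-1 = 0]. *)
Definition deflate P v : 'M[R]_d :=
  let w := v *m P in P - (dot w w)^-1 *: (w^T *m w).

(** The orthogonal projector onto the orthogonal of [s], in matrix arithmetic so as to be measurable
    in [s]; [first_row] below follows a fixed rule for the same reason. *)
Definition annih s : 'M[R]_d := foldr (fun v P => deflate P v) 1%:M s.

Definition orthoproj P := P^T = P /\ P *m P = P.

(** E = w^T w satisfies P E = E P = E and E^2 = c E, so E / c projects onto a line inside the range
    of [P]. *)
Lemma deflate_orthoproj P v : orthoproj P ->
  [/\ orthoproj (deflate P v), v *m deflate P v = 0,
      (forall u, u *m P = 0 -> u *m deflate P v = 0) &
      \tr (deflate P v) = \tr P - (v *m P != 0)%:R].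
Proof.
move=> [PT PP]; rewrite /deflate; set w := v *m P; set c := dot w w.
have wP : w *m P = w by rewrite /w -mulmxA PP.
have PwT : P *m w^T = w^T by have := congr1 trmx wP; rewrite trmx_mul PT.
have vw : v *m w^T = c%:M.
  by rewrite -PwT mulmxA -/w mulmx_dot.
(* Covers c = 0 as well, since then w = 0. *)
have cw : (1 - c^-1 * c) *: w = 0.
  have [/eqP|c0] := eqVneq c 0; last by rewrite mulVf// subrr scale0r.
  by rewrite /c dotvv_eq0 => /eqP ->; rewrite scaler0.
split.
- split; first by rewrite linearB linearZ/= trmx_mul trmxK PT.
  set E := w^T *m w.
  have PE : P *m E = E by rewrite mulmxA PwT.
  have EP : E *m P = E by rewrite -mulmxA wP.
  have EE : E *m E = c *: E.
    by rewrite mulmxA -(mulmxA w^T w) mulmx_dot -/c mul_mx_scalar scalemxAl.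
  have E0 : (1 - c^-1 * c) *: E = 0 by rewrite scalemxAr cw mulmx0.
  rewrite mulmxBr !mulmxBl PP -!scalemxAl -!scalemxAr EP PE EE !scalerA.
  rewrite -[RHS]subr0; congr (_ - _); rewrite -scalerBl.
  by rewrite -[X in (X - _) *: _]mulr1 -mulrA -mulrBr -scalerA E0 scaler0.
- rewrite mulmxBr -/w -scalemxAr mulmxA vw mul_scalar_mx scalerA.
  by rewrite -[X in X - _]scale1r -scalerBl cw.
- move=> u uP; have uw : u *m w^T = 0 by rewrite -PwT mulmxA uP mul0mx.
  by rewrite mulmxBr -scalemxAr mulmxA uw mul0mx uP scaler0 subrr.
rewrite linearB linearZ/= mxtrace_mulC mulmx_dot -/c mxtrace_scalar mulr1n.
by rewrite -dotvv_eq0 -/c; have [->|c0] := eqVneq c 0; rewrite ?mulr0// mulVf.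
Qed.

(** The trace of a projector is its rank, which each nonzero vector lowers by at most one. Zero
    vectors are not counted, because undiscovered rows of [W] are zero. *)
Lemma annihP s : [/\ orthoproj (annih s), (forall v, v \in s -> v *m annih s = 0) &
  (d%:R - (count (predC1 0) s)%:R <= \tr (annih s))].
Proof.
elim: s => [|v s [IH1 IH2 IH3]] /=.
  split=> //; first by split; rewrite ?trmx1 ?mulmx1.
  by rewrite mxtrace1 subr0.
have [H1 H2 H3 H4] := deflate_orthoproj v IH1; split=> //.
  by move=> u; rewrite inE => /predU1P[->//|/IH2/H3].
rewrite H4 natrD opprD addrA addrAC lerB// ler_nat.
by case: (eqVneq v 0) => [->|_]; rewrite ?mul0mx ?eqxx// leq_b1.
Qed.

Definition first_row P : 'rV[R]_d :=
  foldr (fun k u => if row k P == 0 then u else row k P) 0 (enum 'I_d).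

Lemma first_rowP P : P != 0 ->
  first_row P != 0 /\ exists k, first_row P = row k P.
Proof.
move=> P0; have /existsP[k0 k0P] : [exists k, row k P != 0].
  apply: contraNT P0; rewrite negb_exists => /forallP P0.
  by apply/eqP/row_matrixP => k; rewrite row0; apply/eqP; rewrite -[_ == _]negbK.
have : k0 \in enum 'I_d by rewrite mem_enum.
rewrite /first_row; elim: (enum _) => //= k s IH.
have [rk|rk _] := eqVneq (row k P) 0; last by split=> //; exists k.
by rewrite inE => /predU1P[kk0|/IH//]; rewrite kk0 rk eqxx in k0P.
Qed.

Definition fresh s : 'rV[R]_d :=
  let u := first_row (annih s) in (Num.sqrt (dot u u))^-1 *: u.

(** With fewer than [d] nonzero vectors the trace is positive, so the projector has a nonzero row;
    by symmetry its rows are orthogonal to every vector that it kills. *)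
Lemma freshP s : (count (predC1 (0 : 'rV[R]_d)%R) s < d)%N ->
  dot (fresh s) (fresh s) = 1 /\ forall v, v \in s -> dot v (fresh s) = 0.
Proof.
move=> sd; have [[PT PP] Ps trP] := annihP s.
have P0 : annih s != 0.
  apply/eqP => P0; move: trP; rewrite P0 mxtrace0 subr_le0 ler_nat.
  by rewrite leqNgt sd.
have [u0 [k uE]] := first_rowP P0; rewrite /fresh; set u := first_row _ in u0 uE *.
split.
  rewrite dotZl dotC dotZl mulrA -invfM -expr2 sqr_sqrtr ?dotvv_ge0// mulVf//.
  by rewrite dotvv_eq0.
move=> v vs; rewrite dotC dotZl dotC [dot v u](_ : _ = 0) ?mulr0//.
by rewrite /dot uE rowE trmx_mul PT mulmxA Ps// mul0mx mxE.
Qed.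

End fresh.

(** * Orthonormal rows added one at a time *)

Section completion.
Context {R : realType} {n d : nat}.
Implicit Types (x : 'rV[R]_d) (xs : seq 'rV[R]_d) (c : pred 'I_n)
  (W : 'M[R]_(n, d)).

(* The nonzero rows of [W] are orthonormal; a zero row stands for a coordinate
   that has not been discovered yet. *)
Definition orth W := forall k l,
  dot (row k W) (row l W) = ((k == l) && (row k W != 0))%:R.

Definition add_row xs c W (k : 'I_n) : 'M[R]_(n, d) :=
  if (row k W == 0) && c k
  then W + delta_mx k 0 *m fresh (xs ++ [seq row l W | l <- enum 'I_n]) else W.

Definition add_rows xs c W := foldl (add_row xs c) W (enum 'I_n).

(** The invariant of the resisting run: chosen rows are final, and whatever replaces a zero row is
    orthogonal to the queries [xs] already made. *)
Definition extends xs W W' :=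
  (forall k, row k W != 0 -> row k W' = row k W) /\
  (forall k, row k W = 0 -> forall x, x \in xs -> dot x (row k W') = 0).

Lemma extends_trans xs W W' W'' :
  extends xs W W' -> extends xs W' W'' -> extends xs W W''.
Proof.
move=> [a b] [a' b']; split=> k.
  by move=> k0; have := a k k0 => E; rewrite a' ?E.
move=> k0 x xxs; have [k1|k1] := eqVneq (row k W') 0; first exact: b'.
by rewrite a'//; exact: b.
Qed.

Lemma extends_sub xs xs' W W' : {subset xs <= xs'} ->
  extends xs' W W' -> extends xs W W'.
Proof. by move=> xx [a b]; split=> // k k0 x /xx; exact: b. Qed.

Lemma extends_refl xs W : extends xs W W.
Proof. by split=> // k -> x _; rewrite dotC dot0v. Qed.

Lemma add_row_row xs c W k : row k W == 0 -> c k ->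
  (forall l, row l (add_row xs c W k) =
    if l == k then fresh (xs ++ [seq row l W | l <- enum 'I_n]) else row l W).
Proof.
move=> k0 ck l; rewrite /add_row k0 ck; set u := fresh _.
apply/rowP => i; rewrite !mxE big_ord1 mxE eqxx andbT.
have [->|lk] := eqVneq l k; last by rewrite mul0r addr0 mxE.
by move/eqP/rowP/(_ i): k0; rewrite !mxE => ->; rewrite add0r mul1r.
Qed.

Lemma add_rowP xs c W k : (size xs + n <= d)%N -> orth W ->
  [/\ orth (add_row xs c W k), extends xs W (add_row xs c W k) &
      c k -> row k (add_row xs c W k) != 0].
Proof.
move=> xd oW; have [/andP[k0 ck]|kc] := boolP ((row k W == 0) && c k); last first.
  rewrite /add_row (negbTE kc); split=> //; first exact: extends_refl.
  by move=> ck; move: kc; rewrite ck andbT.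
have rE := add_row_row xs k0 ck; set W' := add_row _ _ _ _ in rE *.
set s := xs ++ _ in rE.
have [|f1 fs] := @freshP _ _ s.
  rewrite count_cat count_map; apply: leq_trans xd.
  rewrite -addnS leq_add ?count_size//.
  (* Row [k] is zero, so at most n - 1 rows are nonzero and the count stays below [d]. *)
  rewrite -[leqRHS](size_enum_ord n) -(count_predC (fun l => row l W == 0)).
  rewrite -add1n leq_add//.
  by rewrite -has_count; apply/hasP; exists k; rewrite ?mem_enum.
have fW l : dot (row l W) (fresh s) = 0.
  apply: fs; rewrite mem_cat; apply/orP; right.
  by apply/mapP; exists l; rewrite ?mem_enum.
have f0 : fresh s != 0 by rewrite -dotvv_eq0 f1 oner_eq0.
split.
- move=> l m; rewrite !rE.
  case: (eqVneq l k) => [->|lk]; case: (eqVneq m k) => [mk|mk].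
  + by rewrite f1 f0 ?mk ?eqxx.
  + by rewrite dotC fW eq_sym ?(negbTE mk).
  + by rewrite fW ?mk ?(negbTE lk).
  + exact: oW.
- split=> l.
    by rewrite rE; case: (eqVneq l k) => // ->; rewrite (eqP k0) eqxx.
  move=> l0 x xxs; rewrite rE; case: (eqVneq l k) => [_|_].
    by apply: fs; rewrite mem_cat xxs.
  by rewrite l0 dotC dot0v.
- by rewrite rE eqxx.
Qed.

Lemma add_rowsP xs c W : (size xs + n <= d)%N -> orth W ->
  [/\ orth (add_rows xs c W), extends xs W (add_rows xs c W) &
      forall k, c k -> row k (add_rows xs c W) != 0].
Proof.
move=> xd oW; rewrite /add_rows.
suff H s : [/\ orth (foldl (add_row xs c) W s),
    extends xs W (foldl (add_row xs c) W s) &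
    forall k, k \in s -> c k -> row k (foldl (add_row xs c) W s) != 0].
  by have [? ? H3] := H (enum 'I_n); split=> // k; apply: H3; rewrite mem_enum.
elim/last_ind: s => [|s k [IH1 IH2 IH3]]; first by split=> //; exact: extends_refl.
rewrite foldl_rcons; have [H1 H2 H3] := add_rowP c k xd IH1; split=> //.
  exact: extends_trans IH2 H2.
move=> l; rewrite mem_rcons inE => /predU1P[->//|ls cl].
by rewrite H2.1 IH3.
Qed.

Lemma add_rows_supp xs c W l : row l (add_rows xs c W) != 0 ->
  row l W != 0 \/ c l.
Proof.
rewrite /add_rows; elim/last_ind: (enum _) => [|s k IH]; first by left.
rewrite foldl_rcons; set W' := foldl _ _ _ in IH *.
have [/andP[k0 ck]|kc] := boolP ((row k W' == 0) && c k); last first.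
  by rewrite /add_row (negbTE kc).
rewrite (add_row_row _ k0 ck) => //.
by have [->|_] := eqVneq l k; [right|].
Qed.

Lemma orth0 : orth 0.
Proof. by move=> k l; rewrite row0 dot0v eqxx andbF. Qed.

Lemma orth_full W : orth W -> (forall k, row k W != 0) -> W *m W^T = 1%:M.
Proof.
move=> oW W0; apply/matrixP => k l; have := oW k l; rewrite W0 andbT => E.
by rewrite [RHS]mxE -E dotE mxE; apply: eq_bigr => i _; rewrite !mxE.
Qed.

Lemma row_mulmx_tr x W k : (x *m W^T) ord0 k = dot x (row k W).
Proof. by rewrite dotE mxE; apply: eq_bigr => i _; rewrite !mxE. Qed.

End completion.

Section simulation.
Context {R : realType} {n d : nat}.
Variable a : forall i : nat, i.-tuple (jet R d) -> 'rV[R]_d.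
Implicit Types (h : nat -> jet R n) (f : 'rV[R]_n -> R) (W : 'M[R]_(n, d)).

(* After [i] answers [h 0], ..., [h (i-1)] about [f], the run of [a] on the lift
   [y |-> f (y *m W^T)]: the jets shown to [a], its queries (latest first), and
   the rows of [W] chosen so far. A row is chosen only when its coordinate first
   occurs in an answer, orthogonally to all the queries made until then; hence
   the earlier answers do not depend on this choice. *)
Fixpoint sim h (i : nat) : i.-tuple (jet R d) * seq 'rV[R]_d * 'M[R]_(n, d) :=
  if i is i'.+1 then
    let S := sim h i' in
    let xs := a S.1.1 :: S.1.2 in
    let W := add_rows xs (fun k => `[< exists t, h i' (k :: t) <> 0 >]) S.2 in
    ([tuple of rcons S.1.1 (push_jet W^T (h i'))], xs, W)
  else ([tuple], [::], 0).

Definition sim_query h i : 'rV[R]_d := a (sim h i).1.1.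

Definition sim_iterate h i : 'rV[R]_n := sim_query h i *m (sim h i).2^T.

Lemma eq_sim h h' i : (forall k, (k < i)%N -> h k = h' k) -> sim h i = sim h' i.
Proof.
elim: i => [//|i IH] hh'; have E : sim h i = sim h' i.
  by apply: IH => k ki; apply: hh'; exact: ltnW.
by rewrite /= E (hh' i (ltnSn i)).
Qed.

Lemma size_sim h i : size (sim h i).1.2 = i.
Proof. by elim: i => //= i ->. Qed.

Lemma sim_supp h i k : row k (sim h i).2 != 0 ->
  exists2 s, (s < i)%N & exists t, h s (k :: t) <> 0.
Proof.
elim: i => [|i IH]; first by rewrite row0 eqxx.
move=> /add_rows_supp[/IH[s si H]|/asboolP H]; last by exists i.
by exists s => //; rewrite ltnS ltnW.
Qed.

Lemma sim_iterate_supp h i k : sim_iterate h i ord0 k <> 0 ->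
  exists2 s, (s < i)%N & exists t, h s (k :: t) <> 0.
Proof.
move=> H; apply: sim_supp; apply/eqP => E; apply: H.
by rewrite /sim_iterate row_mulmx_tr E dotC dot0v.
Qed.

(** After [T] queries the missing rows are filled in orthogonally to all of them, and this single
    [W] explains the whole run: every jet shown was the true jet of the lifted function. *)
Lemma sim_resist T f h : smooth f -> (n + T <= d)%N ->
  (forall i, (i < T)%N -> h i = jet_at f (sim_iterate h i)) ->
  exists2 W, W *m W^T = 1%:M & forall i, (i < T)%N ->
    sim_query h i *m W^T = sim_iterate h i /\
    (sim h i.+1).1.1 = [tuple of rcons (sim h i).1.1
      (jet_at (fun y => f (y *m W^T)) (sim_query h i))].
Proof.
move=> sf nTd hE.
pose D i k := `[< exists t, h i (k :: t) <> 0 >].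
have sz i : (i <= T)%N -> (size (sim h i).1.2 + n <= d)%N.
  by move=> iT; rewrite size_sim addnC (leq_trans _ nTd)// leq_add2l.
have oW i : (i <= T)%N -> orth (sim h i).2.
  elim: i => [|i IH] iT; first exact: orth0.
  by have [] := add_rowsP (D i) (sz i.+1 iT) (IH (ltnW iT)).
have stepE i : (i < T)%N -> extends (sim h i.+1).1.2 (sim h i).2 (sim h i.+1).2.
  by move=> iT; have [] := add_rowsP (D i) (sz i.+1 iT) (oW i (ltnW iT)).
have [] := add_rowsP predT (sz T (leqnn T)) (oW T (leqnn T)).
set W := add_rows _ _ _ => oWf extT Wn0.
have extW i : (i <= T)%N -> extends (sim h i).1.2 (sim h i).2 W.
  move=> iT; rewrite -(subKn iT); elim: (T - i)%N => [|j IH]; first by rewrite subn0.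
  have [jT|jT] := leqP T j.
    suff -> : (T - j.+1 = T - j)%N by exact: IH.
    by move: jT (leqW jT); rewrite -!subn_eq0 => /eqP-> /eqP->.
  have E : (T - j)%N = (T - j.+1).+1 by rewrite subnSK.
  rewrite E in IH; have lt : (T - j.+1 < T)%N by rewrite -E leq_subr.
  apply: extends_sub (extends_trans (stepE _ lt) IH).
  by move=> x xi /=; rewrite inE xi orbT.
exists W => [|i iT]; first by apply: orth_full => // k; exact: Wn0.
have ext1 : extends (sim h i.+1).1.2 (sim h i).2 W.
  exact: extends_trans (stepE i iT) (extW i.+1 iT).
(* A row chosen before query [i] is final; a later one is orthogonal to that query, and the zero row
   in its place gave 0 too. *)
have xW : sim_query h i *m W^T = sim_iterate h i.
  apply/rowP => k; rewrite /sim_iterate !row_mulmx_tr.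
  have [k0|k0] := eqVneq (row k (sim h i).2) 0; last by rewrite ext1.1.
  rewrite ext1.2 ?k0//; first by rewrite dotC dot0v.
  by rewrite /= inE eqxx.
split=> //; apply/val_inj => /=; congr (rcons _ _).
rewrite -/(D i); set W' := add_rows _ _ _.
have -> : jet_at (fun y => f (y *m W^T)) (sim_query h i) = push_jet W^T (h i).
  by apply/funext => s; rewrite /jet_at pderiv_mulmx// xW hE.
apply/funext => s.
(* Compare on the rows known after answer [i]: any other coordinate has only zero derivatives in
   that answer, or its row would have been chosen. *)
apply: (@eq_push_jet_on _ _ _ [set k | row k W' != 0]).
  move=> l k; rewrite inE => k0; rewrite !mxE.
  by have := (extW i.+1 iT).1 k k0 => /rowP/(_ l); rewrite !mxE => ->.
move=> t k kt; rewrite inE negbK hE// /jet_at => k0.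
have [t' E] := pderiv_mem sf kt; rewrite E.
apply/eqP/negPn/negP => ne.
have [_ _ /(_ k)] := add_rowsP (D i) (sz i.+1 iT) (oW i (ltnW iT)).
rewrite -/W' k0 => /(_ _)/negP; apply => //.
by apply/asboolP; exists t'; rewrite hE//; apply/eqP.
Qed.

End simulation.

(** * Measurability of the resisting oracle *)

Section cylinders.
Context {R : realType} {T : pointedType} {I : Type}.
Variable coord : I -> T -> R.

Lemma measurable_coord (i : I) :
  measurable_fun [set: g_sigma_algebraType (cylinders coord)]
    (coord i : g_sigma_algebraType (cylinders coord) -> R).
Proof.
move=> _ Y mY; apply: sub_sigma_algebra; exists i => //.
by exists Y.
Qed.

Lemma measurable_cylinders dO (Omega : measurableType dO) (F : Omega -> T) :
  (forall i, measurable_fun setT (coord i \o F)) ->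
  measurable_fun setT (F : Omega -> g_sigma_algebraType (cylinders coord)).
Proof.
move=> mF; apply: (@measurability _ _ _ (g_sigma_algebraType (cylinders coord))
  setT F (cylinders coord)) => //.
move=> _ [_ [i _ [Y mY <-]] <-]; rewrite !setTI.
by have := mF i measurableT Y mY; rewrite setTI.
Qed.

End cylinders.

Section measurable_matrix.
Context {R : realType} dO {Omega : measurableType dO}.

Lemma measurable_inv : measurable_fun [set: R] (@GRing.inv R).
Proof.
rewrite (_ : @GRing.inv R = fun x => if x == 0 then 0 else x^-1); last first.
  by apply/funext => x; case: eqVneq => // ->; rewrite invr0.
apply: measurable_fun_if => //.
  exact: measurable_fun_eqr.
rewrite setTI; apply: open_continuous_measurable_fun.
  rewrite (_ : _ @^-1` _ = [set x : R | x != 0]); first exact: open_neq.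
  by apply/seteqP; split=> x /=; case: eqVneq.
move=> x; rewrite inE /= => /eqP x0; apply: inv_continuous.
by move: x0; case: eqVneq.
Qed.

Definition mxmeas m n (F : Omega -> 'M[R]_(m, n)) :=
  forall i j, measurable_fun setT (fun t => F t i j).

Lemma mxmeas_cst m n (A : 'M[R]_(m, n)) : mxmeas (fun=> A).
Proof. by move=> i j; exact: measurable_cst. Qed.

Lemma mxmeasD m n (F G : Omega -> 'M[R]_(m, n)) :
  mxmeas F -> mxmeas G -> mxmeas (fun t => F t + G t).
Proof.
move=> mF mG i j; under eq_fun do rewrite mxE.
exact: measurable_funD.
Qed.

Lemma mxmeasM m n p (F : Omega -> 'M[R]_(m, n)) (G : Omega -> 'M[R]_(n, p)) :
  mxmeas F -> mxmeas G -> mxmeas (fun t => F t *m G t).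
Proof.
move=> mF mG i j; under eq_fun do rewrite mxE.
by apply: measurable_sum => k; exact: measurable_funM.
Qed.

Lemma mxmeasZ m n (c : Omega -> R) (F : Omega -> 'M[R]_(m, n)) :
  measurable_fun setT c -> mxmeas F -> mxmeas (fun t => c t *: F t).
Proof.
move=> mc mF i j; under eq_fun do rewrite mxE.
exact: measurable_funM.
Qed.

Lemma mxmeas_tr m n (F : Omega -> 'M[R]_(m, n)) :
  mxmeas F -> mxmeas (fun t => (F t)^T).
Proof. by move=> mF i j; under eq_fun do rewrite mxE; exact: mF. Qed.

Lemma mxmeas_row m n (F : Omega -> 'M[R]_(m, n)) k :
  mxmeas F -> mxmeas (fun t => row k (F t)).
Proof. by move=> mF i j; under eq_fun do rewrite mxE; exact: mF. Qed.

Lemma mxmeas_if m n (b : Omega -> bool) (F G : Omega -> 'M[R]_(m, n)) :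
  measurable_fun setT b -> mxmeas F -> mxmeas G ->
  mxmeas (fun t => if b t then F t else G t).
Proof.
move=> mb mF mG i j.
rewrite (_ : (fun _ => _) = (fun t => if b t then F t i j else G t i j)).
  exact: measurable_fun_ifT.
by apply/funext => t; case: (b t).
Qed.

Lemma measurable_dot d (F G : Omega -> 'rV[R]_d) : mxmeas F -> mxmeas G ->
  measurable_fun setT (fun t => dot (F t) (G t)).
Proof. by move=> mF mG; exact: (mxmeasM mF (mxmeas_tr mG)). Qed.

Lemma measurable_row_eq0 d (F : Omega -> 'rV[R]_d) : mxmeas F ->
  measurable_fun setT (fun t => F t == 0).
Proof.
move=> mF; under eq_fun do rewrite -dotvv_eq0.
by apply: measurable_fun_eqr; [exact: measurable_dot|exact: measurable_cst].
Qed.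

(** The length is the same for all [t], so inductions can run over the measurable functions [fs]. *)
Definition seqmeas d (F : Omega -> seq 'rV[R]_d) :=
  exists2 fs, List.Forall (@mxmeas 1 d) fs & forall t, F t = [seq f t | f <- fs].

Lemma seqmeas_cons d (f : Omega -> 'rV[R]_d) F :
  mxmeas f -> seqmeas F -> seqmeas (fun t => f t :: F t).
Proof.
move=> mf [fs mfs FE]; exists (f :: fs); first exact: List.Forall_cons.
by move=> t; rewrite FE.
Qed.

Lemma seqmeas_cat d (F G : Omega -> seq 'rV[R]_d) :
  seqmeas F -> seqmeas G -> seqmeas (fun t => F t ++ G t).
Proof.
move=> [fs mfs FE] [gs mgs GE]; exists (fs ++ gs); first by apply/List.Forall_app.
by move=> t; rewrite FE GE map_cat.
Qed.

Lemma seqmeas_rows n d (F : Omega -> 'M[R]_(n, d)) :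
  mxmeas F -> seqmeas (fun t => [seq row l (F t) | l <- enum 'I_n]).
Proof.
move=> mF; exists [seq (fun t => row l (F t)) | l <- enum 'I_n].
  by elim: (enum _) => [|l s IH]; constructor => //; exact: mxmeas_row.
by move=> t; rewrite -map_comp.
Qed.

Lemma mxmeas_annih d (F : Omega -> seq 'rV[R]_d) :
  seqmeas F -> mxmeas (fun t => annih (F t)).
Proof.
move=> [fs mfs FE]; under eq_fun do rewrite FE.
elim: mfs {FE} => [|f {}fs mf _ IH]; first exact: mxmeas_cst.
rewrite /= /deflate; have mw := mxmeasM mf IH.
apply: mxmeasD IH _; rewrite (_ : (fun _ => _) = fun t => (-1 : R) *:
   ((dot (f t *m annih [seq f t | f <- fs]) (f t *m annih [seq f t | f <- fs]))^-1 *: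
    ((f t *m annih [seq f t | f <- fs])^T *m (f t *m annih [seq f t | f <- fs])))).
  apply: mxmeasZ; first exact: measurable_cst.
  apply: mxmeasZ; last exact: mxmeasM (mxmeas_tr mw) mw.
  by apply: (measurableT_comp measurable_inv); exact: measurable_dot.
by apply/funext => t; rewrite scaleN1r.
Qed.

Lemma mxmeas_first_row d (F : Omega -> 'M[R]_d) :
  mxmeas F -> mxmeas (fun t => first_row (F t)).
Proof.
move=> mF; rewrite /first_row; elim: (enum _) => [|k s IH] /=.
  exact: mxmeas_cst.
apply: mxmeas_if => //; last exact: mxmeas_row.
exact/measurable_row_eq0/mxmeas_row.
Qed.

Lemma mxmeas_fresh d (F : Omega -> seq 'rV[R]_d) :
  seqmeas F -> mxmeas (fun t => fresh (F t)).
Proof.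
move=> mF; rewrite /fresh; have mr := mxmeas_first_row (mxmeas_annih mF).
apply: mxmeasZ => //; apply: (measurableT_comp measurable_inv).
apply: (@measurableT_comp _ _ _ _ _ _ (@Num.sqrt R)); last exact: measurable_dot.
apply: continuous_measurable_fun; exact: sqrt_continuous.
Qed.

Lemma mxmeas_add_rows n d (Fs : Omega -> seq 'rV[R]_d) (c : Omega -> pred 'I_n)
    (F : Omega -> 'M[R]_(n, d)) :
  seqmeas Fs -> (forall k, measurable_fun setT (c ^~ k)) -> mxmeas F ->
  mxmeas (fun t => add_rows (Fs t) (c t) (F t)).
Proof.
move=> mFs mc mF; rewrite /add_rows.
elim/last_ind: (enum _) => [|s k IH]; first exact: mF.
under eq_fun do rewrite foldl_rcons; rewrite /add_row.
apply: mxmeas_if => //; last first.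
  apply: mxmeasD => //; apply: mxmeasM; first exact: mxmeas_cst.
  by apply: mxmeas_fresh; apply: seqmeas_cat => //; exact: seqmeas_rows.
apply: measurable_and => //.
exact/measurable_row_eq0/mxmeas_row.
Qed.

Lemma measurable_push_jet m n (F : Omega -> 'M[R]_(m, n))
    (J : Omega -> jet R n) (s : seq 'I_m) :
  mxmeas F -> (forall t, measurable_fun setT (J ^~ t)) ->
  measurable_fun setT (fun t => push_jet (F t) (J t) s).
Proof.
move=> mF; elim: s J => [|i s IH] J mJ /=; first exact: mJ.
apply: measurable_sum => k; apply: measurable_funM; first exact: mF.
by apply: (IH (fun t u => J t (k :: u))) => u; exact: mJ.
Qed.

(** A countable union. With multi-indices for [I], it makes the discovery of a coordinate a
    measurable event. *)
Lemma measurable_exists_neq0 (I : countType) (f : Omega -> I -> R) :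
  (forall i, measurable_fun setT (f ^~ i)) ->
  measurable_fun setT (fun t => `[< exists i, f t i <> 0 >]).
Proof.
move=> mf; apply: (@measurable_fun_bool _ _ _ _ true).
rewrite setTI (_ : _ @^-1` _ = \bigcup_k
  (if unpickle k is Some i then [set t | f t i != 0] else set0)).
  apply: bigcupT_measurable => k; case: unpickle => [i|//].
  rewrite (_ : [set t | _] = ~` (f ^~ i @^-1` [set 0])).
    apply: measurableC; rewrite -[X in measurable X]setTI.
    exact: (mf i measurableT _ (measurable_set1 0)).
  by apply/seteqP; split=> t /= /eqP.
apply/seteqP; split=> t /=.
  move=> /asboolP[i fi]; exists (pickle i) => //; rewrite pickleK.
  exact/eqP.
by move=> [k _]; case: unpickle => // i /eqP fi; apply/asboolP; exists i.
Qed.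

End measurable_matrix.

Section resisting.
Context {R : realType}.
(** [D n] is the dimension in which [A] is run when the function queried has [n] variables. *)
Variables (A : rand_alg R) (D : nat -> nat).

(** The measurability of [A] is given for seeds in [0, 1], where the fixed seed 0 lies. *)
Lemma alg_measE d i dO (Omega : measurableType dO)
    (J : Omega -> i.-tuple (jet R d)) :
  (forall k s, measurable_fun setT (fun t => tnth (J t) k s)) ->
  mxmeas (fun t => alg_map A (0, J t)).
Proof.
move=> mJ i0 j; rewrite (ord1 i0).
have mJ' : measurable_fun setT
    (fun t => (0, J t) : measurableTypeR R * i.-tuple (meas_jet R d)).
  apply: measurable_fun_pair; first exact: measurable_cst.
  apply/measurable_fun_tnthP => k; apply: measurable_cylinders => s.
  exact: mJ.
have mA := @alg_meas R A d i.
have mD : measurable ([set xi : measurableTypeR R | xi \in `[0, 1]] `*`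
                    [set: i.-tuple (meas_jet R d)]).
  by apply: measurableX => //; exact: measurable_itv.
have sub : (fun t => (0, J t)) @` [set: Omega] `<=`
    [set xi : measurableTypeR R | xi \in `[0, 1]] `*` [set: i.-tuple (meas_jet R d)].
  by move=> _ [t _ <-]; split=> //=; rewrite in_itv/= lexx ler01.
have H := measurable_comp mD sub mA mJ'.
apply: (@measurableT_comp _ _ _ _ _ _ (fun x : meas_rV R d => x ord0 j) setT
  (fun t => alg_map A (0, J t) : meas_rV R d)) => //.
exact: measurable_coord.
Qed.

Definition query d i (J : i.-tuple (jet R d)) : 'rV[R]_d := alg_map A (0, J).

Lemma measurable_sim n d dO (Omega : measurableType dO)
    (h : Omega -> nat -> jet R n) i :
  (forall k s, measurable_fun setT (fun t => h t k s)) ->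
  [/\ forall k s, measurable_fun setT
        (fun t => tnth (sim (@query d) (h t) i).1.1 k s),
      seqmeas (fun t => (sim (@query d) (h t) i).1.2) &
      mxmeas (fun t => (sim (@query d) (h t) i).2)].
Proof.
move=> mh; elim: i => [|i [IH1 IH2 IH3]] /=.
  split; first by case.
    by exists [::] => //; constructor.
  exact: mxmeas_cst.
have mxs : seqmeas (fun t => query (sim (@query d) (h t) i).1.1 ::
    (sim (@query d) (h t) i).1.2).
  by apply: seqmeas_cons => //; exact: alg_measE.
have mW : mxmeas (fun t => add_rows (query (sim (@query d) (h t) i).1.1 ::
    (sim (@query d) (h t) i).1.2)
    (fun k => `[< exists u, h t i (k :: u) <> 0 >]) (sim (@query d) (h t) i).2).
  apply: mxmeas_add_rows => // k.
  by apply: measurable_exists_neq0 => u; exact: mh.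
split=> // k s.
have [ki|ki] := ltnP k i.
  rewrite (_ : (fun _ => _) = fun t =>
    tnth (sim (@query d) (h t) i).1.1 (Ordinal ki) s); first exact: IH1.
  apply/funext => t; congr (_ s).
  by rewrite !(tnth_nth (fun=> 0))/= nth_rcons size_tuple ki.
rewrite (_ : (fun _ => _) = fun t => push_jet (add_rows
    (query (sim (@query d) (h t) i).1.1 :: (sim (@query d) (h t) i).1.2)
    (fun k => `[< exists u, h t i (k :: u) <> 0 >])
    (sim (@query d) (h t) i).2)^T (h t i) s).
  by apply: measurable_push_jet; [exact: mxmeas_tr|move=> u; exact: mh].
apply/funext => t; congr (_ s).
have -> : k = ord_max by apply/val_inj/eqP; rewrite eqn_leq ki -ltnS ltn_ord.
by rewrite (tnth_nth (fun=> 0))/= nth_rcons size_tuple ltnn eqxx.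
Qed.

(* The seed [p.1] is ignored: [A] is run with the seed [0]. *)
Definition resisting_map n i (p : R * i.-tuple (jet R n)) : 'rV[R]_n :=
  sim_iterate (@query (D n)) (nth (fun=> 0) p.2) i.

Lemma measurable_resisting_map n i :
  measurable_fun ([set xi : measurableTypeR R | xi \in `[0, 1]] `*`
                    [set: i.-tuple (meas_jet R n)])
      (@resisting_map n i : measurableTypeR R * i.-tuple (meas_jet R n) ->
                     meas_rV R n).
Proof.
apply: measurable_funTS; apply: measurable_cylinders => j.
have mh k s : measurable_fun setT (fun p : measurableTypeR R * i.-tuple (meas_jet R n) =>
    (nth (fun=> 0) (p.2 : i.-tuple (jet R n)) k : jet R n) s).
  have [ki|ki] := ltnP k i; last first.
    rewrite (_ : (fun _ => _) = cst (0 : R)); first exact: measurable_cst.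
    by apply/funext => p; rewrite nth_default// size_tuple.
  rewrite (_ : (fun _ => _) = (fun x : meas_jet R n => x s) \o
     ((fun J : i.-tuple (meas_jet R n) => tnth J (Ordinal ki)) \o snd)).
    apply: measurableT_comp; first exact: measurable_coord.
    by apply: measurableT_comp => //; exact: measurable_tnth.
  by apply/funext => p /=; rewrite (tnth_nth (fun=> 0)).
have [m1 _ m3] := measurable_sim (D n) i mh.
have := mxmeasM (alg_measE m1) (mxmeas_tr m3); exact.
Qed.

Definition resisting_alg : rand_alg R := RandAlg measurable_resisting_map.

End resisting.

(** * Deterministic versus zero-respecting complexity *)

Section resisting_runs.
Context {R : realType}.
Implicit Types (A : rand_alg R) (D : nat -> nat).

Lemma nth_history A d (f : 'rV[R]_d -> R) xi i k : (k < i)%N ->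
  nth (fun=> 0) (history A f xi i) k = jet_at f (iterate A f k xi).
Proof.
elim: i => // i IH ki; rewrite /= nth_rcons size_tuple.
have [ki'|ik] := ltnP k i; first exact: IH.
have -> : k = i by apply/eqP; rewrite eqn_leq ik -ltnS ki.
by rewrite eqxx.
Qed.

Lemma iterate_resisting A D n (f : 'rV[R]_n -> R) xi i :
  iterate (resisting_alg A D) f i xi = sim_iterate (@query R A (D n))
    (fun k => jet_at f (iterate (resisting_alg A D) f k xi)) i.
Proof.
rewrite {1}/iterate/= /resisting_map /sim_iterate /sim_query.
rewrite (@eq_sim _ _ _ _ _
  (fun k => jet_at f (iterate (resisting_alg A D) f k xi)))// => k ki.
exact: nth_history.
Qed.

Lemma iterate_resisting_seed A D n (f : 'rV[R]_n -> R) xi xi' i :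
  iterate (resisting_alg A D) f i xi = iterate (resisting_alg A D) f i xi'.
Proof.
elim/ltn_ind: i => i IH; rewrite !iterate_resisting /sim_iterate /sim_query.
rewrite (@eq_sim _ _ _ _ _
  (fun k => jet_at f (iterate (resisting_alg A D) f k xi')))// => k ki.
by rewrite IH.
Qed.

Lemma resisting_zr A D : A_zr (resisting_alg A D).
Proof.
split=> // n f sf xi _ t k kt.
have : iterate (resisting_alg A D) f t xi ord0 k <> 0 by exact: kt.
rewrite iterate_resisting => /sim_iterate_supp[s st [u fu]].
exists (size u) => //; exists s => //= E; apply: fu.
by have /(congr1 (fun g => g (in_tuple u))) := E.
Qed.

(** By induction the history of [A] on the lift consists of the jets made up by [sim]; determinism
    exchanges the seed [xi] for the seed 0 of [query]. *)
Lemma resisting_det A D n T (f : 'rV[R]_n -> R) :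
  A_det A -> smooth f -> (n + T <= D n)%N ->
  exists2 W : 'M[R]_(n, D n), W *m W^T = 1%:M &
    forall i xi xi', (i < T)%N -> xi \in `[0, 1] ->
    iterate A (fun y => f (y *m W^T)) i xi *m W^T =
    iterate (resisting_alg A D) f i xi'.
Proof.
move=> [_ Adet] sf nT.
pose h k := jet_at f (iterate (resisting_alg A D) f k 0).
have [|W WW HW] := @sim_resist R n (D n) (@query R A (D n)) T f h sf nT.
  by move=> i _; rewrite /h iterate_resisting.
exists W => // i xi xi' iT xi01.
have zero01 : (0 : R) \in `[0, 1] by rewrite in_itv/= lexx ler01.
have hist j : (j <= T)%N -> history A (fun y => f (y *m W^T)) xi j =
    (sim (@query R A (D n)) h j).1.1.
  elim: j => // j IH jT; have [_ ->] := HW j jT.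
  rewrite [LHS]/= IH ?(ltnW jT)//; apply/val_inj => /=; congr rcons.
  by congr jet_at; apply: Adet.
rewrite (iterate_resisting_seed _ _ _ _ 0) iterate_resisting -/h.
have [<- _] := HW i iT; congr (_ *m _).
rewrite /iterate hist ?(ltnW iT)//.
exact: Adet.
Qed.

End resisting_runs.

(** * Lifting along orthonormal rows *)

Section isometry.
Context {R : realType}.

Lemma enorm_dot d (v : 'rV[R]_d) : enorm v = Num.sqrt (dot v v).
Proof.
by rewrite /enorm dotE; congr Num.sqrt; apply: eq_bigr => i _; rewrite expr2.
Qed.

Context {n d : nat} (W : 'M[R]_(n, d)).
Hypothesis WW : W *m W^T = 1%:M.

(** W^T W is an orthogonal projector, and the squared norms differ by that of v - v W^T W. *)
Lemma enorm_mulmx_le (v : 'rV[R]_d) : enorm (v *m W^T) <= enorm v.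
Proof.
rewrite !enorm_dot ler_wsqrtr// -subr_ge0.
suff -> : dot v v - dot (v *m W^T) (v *m W^T) =
    dot (v - v *m W^T *m W) (v - v *m W^T *m W) by exact: dotvv_ge0.
set u := v *m W^T; have uE : u^T = W *m v^T by rewrite trmx_mul trmxK.
have E : (v - u *m W)^T = v^T - W^T *m u^T by rewrite linearB/= trmx_mul.
rewrite /dot E mulmxBl !mulmxBr -!mulmxA -uE !mulmxA -/u.
by rewrite -[u *m W *m W^T]mulmxA WW mulmx1 subrr subr0 !mxE.
Qed.

Lemma enorm_mulmx (v : 'rV[R]_n) : enorm (v *m W) = enorm v.
Proof.
by rewrite !enorm_dot /dot trmx_mul mulmxA -[v *m W *m W^T]mulmxA WW mulmx1.
Qed.

Lemma grad_mulmx (f : 'rV[R]_n -> R) (y : 'rV[R]_d) : smooth f ->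
  grad (fun z => f (z *m W^T)) y = grad f (y *m W^T) *m W.
Proof.
move=> sf; apply/rowP => i; rewrite !mxE pderiv_mulmx//=.
by apply: eq_bigr => k _; rewrite !mxE mulrC.
Qed.

(** Lines go to lines whose direction still has norm at most 1, [0] goes to [0], and the values of
    the lift are among those of [f]. *)
Lemma Fclass_mulmx p (Delta L : R) (f : 'rV[R]_n -> R) : (0 < d)%N ->
  Fclass p Delta L f -> Fclass p Delta L (fun z => f (z *m W^T)).
Proof.
move=> d0 [_ sf [_ lf] fD].
have sfW : smooth (fun z => f (z *m W^T)) by exact: smooth_mulmx.
split=> //.
- split; first exact: sfW.
  move=> x v v1 t t'.
  have := lf (x *m W^T) (v *m W^T) (le_trans (enorm_mulmx_le v) v1) t t'.
  rewrite /= (_ : (fun u => f (x *m W^T + u *: (v *m W^T))) =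
    (fun u => f ((x + u *: v) *m W^T)))//.
  by apply/funext => u; rewrite mulmxDl scalemxAl.
rewrite mul0mx; apply: le_trans fD; apply: leeB => //.
by apply: ereal_inf_le_tmp => _ [x _ <-]; exists (x *m W^T).
Qed.

End isometry.

Section time.
Context {R : realType}.
Implicit Types (A : rand_alg R).
Local Open Scope ereal_scope.

Lemma alg_time_ge A (eps : R) d (f : 'rV[R]_d -> R) (T : nat) :
  (forall xi s, (xi \in `[0%R, 1%R])%R -> (s < T)%N ->
     (eps < enorm (grad f (iterate A f s xi)))%R) ->
  (T.+1%:R)%:E <= alg_time A eps f.
Proof.
move=> H; apply: le_ereal_inf_tmp => _ [t [t0 Pt] <-].
rewrite lee_fin ler_nat ltnNge; apply/negP => tT.
move: Pt; rewrite [X in X <= _](_ : _ = 1).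
  by rewrite lee_fin => h; lra.
apply: integral_uniform_pdf1 => // xi xi01 s st; apply: H => //.
exact: leq_trans st tT.
Qed.

Lemma alg_time_le A (eps : R) d (f : 'rV[R]_d -> R) (t s : nat) :
  (s < t)%N -> (forall xi, (enorm (grad f (iterate A f s xi)) <= eps)%R) ->
  alg_time A eps f <= (t%:R)%:E.
Proof.
move=> st H; apply: ereal_inf_lbound; exists t => //; split.
  exact: leq_ltn_trans st.
rewrite (_ : [set w | _] = set0) ?measure0 ?lee_fin ?invr_ge0//.
by apply/seteqP; split=> // xi /(_ s st); rewrite ltNge H.
Qed.

(** If no seed in [0, 1] were good, the event would have probability one. One good seed suffices, as
    a deterministic run is the same for all of them. *)
Lemma alg_time_witness A (eps : R) d (f : 'rV[R]_d -> R) (t : nat) :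
  uniform_prob (@ltr01 R) [set xi | forall s, (s < t)%N ->
     (eps < enorm (grad f (iterate A f s xi)))%R] <= (2^-1)%:E ->
  exists2 s, (s < t)%N & exists2 xi, (xi \in `[0%R, 1%R])%R &
    (enorm (grad f (iterate A f s xi)) <= eps)%R.
Proof.
move=> P; apply: contrapT => H; move: P.
rewrite [X in X <= _](_ : _ = 1).
  by rewrite lee_fin => h; lra.
apply: integral_uniform_pdf1 => // xi xi01 s st /=; rewrite ltNge; apply/negP => le.
by apply: H; exists s => //; exists xi.
Qed.

Lemma complexity_zr_le_det p (Delta L eps : R) :
  complexity eps (@A_zr R) (Fclass p Delta L) <=
  complexity eps (@A_det R) (Fclass p Delta L).
Proof.
apply: le_ereal_inf_tmp => _ [A Adet <-]; set S := ereal_sup _.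
have [->|Soo] := eqVneq S +oo; first exact: leey.
have [T0 ST] : exists T0 : nat, S <= (T0%:R)%:E.
  case: S Soo => [r _|//|_]; last by exists 0%N; exact: leNye.
  by exists (Num.truncn r).+1; rewrite lee_fin ltW// truncnS_gt.
(* Room for [n] rows and [T0] queries, whatever [f]. *)
pose D n := (n + T0)%N.
apply: (@le_trans _ _ (ereal_sup [set u | exists (d : nat) (f : 'rV[R]_d -> R),
   Fclass p Delta L f /\ u = alg_time (resisting_alg A D) eps f])).
  by apply: ereal_inf_lbound; exists (resisting_alg A D) => //; exact: resisting_zr.
apply: ge_ereal_sup => _ [n [f [Ff ->]]].
have sf : smooth f by case: Ff.
have [W WW HW] := resisting_det Adet sf (leqnn (D n)).
have FW : Fclass p Delta L (fun z => f (z *m W^T)).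
  by apply: Fclass_mulmx => //; case: Ff => n0 _ _ _; rewrite addn_gt0 n0.
have SW : alg_time A eps (fun z => f (z *m W^T)) <= S.
  by apply: ereal_sup_ubound; exists (D n), (fun z => f (z *m W^T)).
have key t : (t <= T0)%N -> uniform_prob (@ltr01 R) [set xi | forall s, (s < t)%N ->
     (eps < enorm (grad (fun z => f (z *m W^T))
       (iterate A (fun z => f (z *m W^T)) s xi)))%R] <= (2^-1)%:E ->
  alg_time (resisting_alg A D) eps f <= (t%:R)%:E.
  move=> tT /alg_time_witness[s st [xi xi01 le]].
  have sT := leq_trans st tT; apply: (alg_time_le st) => xi'.
  rewrite (grad_mulmx W _ sf) (enorm_mulmx WW) in le.
  by rewrite -(HW s xi xi' sT xi01).
apply: (le_trans _ SW); apply: le_ereal_inf_tmp => _ [t [t0 Pt] <-].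
have [tT|Tt] := leqP t T0; first exact: key.
(* A time [t] beyond [T0] is outside the simulated part of the run, but the time on the lift is at
   most [T0], so some t' <= T0 < t qualifies too. *)
have : alg_time A eps (fun z => f (z *m W^T)) < (T0.+1%:R)%:E.
  by apply: le_lt_trans SW _; apply: le_lt_trans ST _; rewrite lte_fin ltr_nat.
move=> /ereal_inf_lt[_ [t' [t'0 Pt'] <-]]; rewrite lte_fin ltr_nat ltnS => t'T.
apply: le_trans (key _ t'T Pt') _; rewrite lee_fin ler_nat.
by rewrite ltnW// (leq_ltn_trans t'T).
Qed.

End time.

(** * The hard instance *)

Section term.
Context {R : realType} {d : nat}.
Implicit Types (a b x v : 'rV[R]_d) (al be : R) (vs : seq 'rV[R]_d).

Lemma continuous_dot a al : continuous (fun z => dot a z + al).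
Proof.
have cd : continuous (dot a).
  rewrite (_ : dot a = fun z => \sum_(i < d) a ord0 i * z ord0 i); last first.
    by apply/funext => y; rewrite dotE.
  apply: continuous_big => [|i _]; first exact: add_continuous.
  apply: continuous_scale; exact: coord_continuous.
move=> z; exact: (cvgD (cd z) (cvg_cst al)).
Qed.

(* The iterated derivative along [vs] of
   [x |-> flatn m 0 (dot a x + al) * flatn n 0 (dot b x + be)]. *)
Fixpoint dterm a al b be vs m n x : R :=
  if vs is v :: vs' then
    dot a v * dterm a al b be vs' m.+1 n x + dot b v * dterm a al b be vs' m n.+1 x
  else flatn m 0 (dot a x + al) * flatn n 0 (dot b x + be).

Lemma is_derive_flatn_dot a al n x v :
  is_derive x v (fun z => flatn n 0 (dot a z + al))
    (dot a v * flatn n.+1 0 (dot a x + al)).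
Proof.
have E h : dot a (h *: v + x) + al = dot a v * h + (dot a x + al).
  by rewrite /dot linearD linearZ/= mulmxDr -scalemxAr !mxE; ring.
have dA : is_derive (0 : R) 1 (fun h => dot a v * h + (dot a x + al)) (dot a v).
  have H1 := is_deriveZ (dot a v) (is_derive_id (0 : R) 1).
  have := is_deriveD H1 (is_derive_cst (dot a x + al) (0 : R) 1).
  by rewrite addr0 [_ *: 1]mulr1.
have dF : is_derive (dot a v * 0 + (dot a x + al)) 1 (flatn n 0)
    (flatn n.+1 0 (dot a x + al)).
  by rewrite mulr0 add0r; exact: is_derive_flatn.
have := is_derive1_comp (g := fun h : R => dot a v * h + (dot a x + al)) dF dA.
rewrite mulrC => /is_derive_cvg H.
apply: cvg_is_derive; apply: cvg_trans H; apply: near_eq_cvg; near=> h => /=.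
by rewrite mulr0 add0r addr0 [h%:A]mulr1 E.
Unshelve. all: by end_near. Qed.

Lemma is_derive_dterm a al b be vs m n x v :
  is_derive x v (dterm a al b be vs m n) (dterm a al b be (v :: vs) m n x).
Proof.
elim: vs m n => [|w vs IH] m n.
  have H1 := is_derive_flatn_dot a al m x v.
  have H2 := is_derive_flatn_dot b be n x v.
  have := is_deriveM H1 H2; rewrite /= => H.
  apply: (is_derive_eq H); rewrite /GRing.scale/=; ring.
have H1 := is_deriveZ (dot a w) (IH m.+1 n).
have H2 := is_deriveZ (dot b w) (IH m n.+1).
apply: (is_derive_eq (is_deriveD H1 H2)); rewrite /GRing.scale/=; ring.
Qed.

Lemma continuous_flatn n j : continuous (@flatn R n j).
Proof.
move=> x; apply/differentiable_continuous/derivable1_diffP.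
by have [] := is_derive_flatn n j x.
Qed.

Lemma continuous_dterm a al b be vs m n : continuous (dterm a al b be vs m n).
Proof.
elim: vs m n => [|w vs IH] m n x.
  have c (e : 'rV[R]_d) (ep : R) k : continuous (fun z => flatn k 0 (dot e z + ep)).
    move=> z; apply: (@continuous_comp 'rV[R]_d R R (fun z => dot e z + ep)).
      exact: continuous_dot.
    exact: continuous_flatn.
  exact: (cvgM (c a al m x) (c b be n x)).
exact: (cvgD (@continuous_scale _ _ (dot a w) _ (IH m.+1 n) x)
  (@continuous_scale _ _ (dot b w) _ (IH m n.+1) x)).
Qed.

Lemma leq_fact2 k l : (k`! * l`! <= (k + l)`!)%N.
Proof. by rewrite -(bin_fact (leq_addr l k)) addKn leq_pmull// bin_gt0 leq_addr. Qed.

(** Each derivative falls on one of two factors, which costs 2, and [flatn_bound] costs another 2;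
    the factorials merge by (2m)! (2n)! <= (2m + 2n)!. *)
Lemma dterm_bound a al b be vs m n x (mu : R) : 0 <= mu ->
  (forall v, v \in vs -> `|dot a v| <= mu /\ `|dot b v| <= mu) ->
  `|dterm a al b be vs m n x| <= (4 * mu) ^+ size vs *
    (2 ^+ (m + n) * (2 * (size vs + m + n))`!%:R).
Proof.
move=> mu0; elim: vs m n => [|v vs IH] m n H.
  rewrite expr0 mul1r add0n normrM exprD mulnDr.
  apply: le_trans (ler_pM _ _ (flatn_bound m 0 _) (flatn_bound n 0 _)) _ => //.
  rewrite !add0n mulrACA ler_wpM2l ?mulr_ge0 ?exprn_ge0//.
  by rewrite -natrM ler_nat leq_fact2.
have Hvs u : u \in vs -> `|dot a u| <= mu /\ `|dot b u| <= mu.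
  by move=> uvs; apply: H; rewrite inE uvs orbT.
have [av bv] := H v (mem_head _ _).
apply: le_trans (ler_normD _ _) _; rewrite !normrM /=.
apply: le_trans (lerD (ler_pM _ _ av (IH m.+1 n Hvs)) (ler_pM _ _ bv (IH m n.+1 Hvs))) _ => //.
rewrite !addnS !addSn !exprS; rewrite le_eqVlt; apply/orP; left; apply/eqP; ring.
Qed.

Lemma dterm_flat a al b be vs m n x : dot a x + al <= 0 ->
  dterm a al b be vs m n x = 0.
Proof.
move=> x0; elim: vs m n => [|v vs IH] m n /=; first by rewrite flatn_le0 ?mul0r.
by rewrite !IH !mulr0 addr0.
Qed.

Lemma dterm_indep a al b be v vs m n x : dot a v = 0 -> dot b v = 0 ->
  dterm a al b be (v :: vs) m n x = 0.
Proof. by move=> /= -> ->; rewrite !mul0r addr0. Qed.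

End term.

Section chain.
Context {R : realType} {d : nat}.
Variables (T : nat) (lam s : R).
Hypotheses (lam0 : 0 < lam) (s0 : 0 < s).
Implicit Types (x v : 'rV[R]_d) (i j k : 'I_d) (vs : seq 'rV[R]_d).

(** Reads off the coordinate before [i] as a dot product, which is 0 for i = 0; the offset in [link]
    then supplies y_(-1) = 1. *)
Definition prev i : 'rV[R]_d := \row_j (j.+1 == i :> nat)%:R.

Definition link (sg : R) i vs x : R :=
  dterm ((sg * s) *: prev i) (sg * (i == 0 :> nat)%:R)
        ((sg * s) *: delta_mx ord0 i) 2 vs 0 0 x.

(* For [vs = [::]] this is the rescaled chain
   [lam * \sum_(i < T) (psi (- y_(i-1)) psi (2 - y_i) - psi (y_(i-1)) psi (2 + y_i))]
   where [y = s *: x], [psi = flat 0], indices start at [0] and [y_(-1) = 1]; for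
   general [vs] it is its iterated derivative along [vs]. *)
Definition chain vs x : R :=
  \sum_(i < d) (lam * (i < T)%:R) * (link (-1) i vs x - link 1 i vs x).

Lemma dot_delta i v : dot (delta_mx ord0 i) v = v ord0 i.
Proof.
rewrite dotE (bigD1 i)//= big1 => [|j ji]; rewrite !mxE eqxx.
  by rewrite eqxx mul1r addr0.
by rewrite (negbTE ji) mul0r.
Qed.

Lemma dot_prev0 i v : i = 0 :> nat -> dot (prev i) v = 0.
Proof. by move=> i0; rewrite dotE big1// => j _; rewrite mxE i0 mul0r. Qed.

Lemma dot_prevS i j v : j.+1 = i :> nat -> dot (prev i) v = v ord0 j.
Proof.
move=> ji; rewrite dotE (bigD1 j)//= big1 => [|k kj]; rewrite mxE -ji.
  by rewrite eqxx mul1r addr0.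
by rewrite eqSS (_ : (k == j :> nat) = false) ?mul0r//; exact/negbTE.
Qed.

Lemma prevP i : i = 0 :> nat \/ exists j, j.+1 = i :> nat.
Proof.
case: i => [[|k] ki] /=; first by left.
by right; exists (Ordinal (ltnW ki)).
Qed.

Lemma sum_dot_prev_sqr v :
  \sum_(i < d) dot (prev i) v ^+ 2 <= \sum_(i < d) v ord0 i ^+ 2.
Proof.
apply: (@le_trans _ _ (\sum_(i < d) \sum_(j < d) (j.+1 == i :> nat)%:R * v ord0 j ^+ 2)).
  apply: ler_sum => i _; have [i0|[j ji]] := prevP i.
    by rewrite dot_prev0// expr0n/= sumr_ge0// => j _; rewrite mulr_ge0 ?sqr_ge0.
  rewrite (dot_prevS _ ji) (bigD1 j)//= ji eqxx mul1r lerDl.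
  by rewrite sumr_ge0// => k _; rewrite mulr_ge0 ?sqr_ge0.
rewrite exchange_big/=; apply: ler_sum => j _; rewrite -mulr_suml.
rewrite -[leRHS]mul1r ler_wpM2r ?sqr_ge0//.
have [jd|jd] := ltnP j.+1 d; last first.
  rewrite big1 ?ler01// => i _; rewrite (_ : (_ == _) = false)//.
  by apply/negbTE; rewrite neq_ltn (leq_trans (ltn_ord i) jd) orbT.
rewrite (bigD1 (Ordinal jd))//= eqxx big1 ?addr0// => i ij.
by rewrite eq_sym (_ : (i == j.+1 :> nat) = false)//; exact/negbTE.
Qed.

Lemma enorm_le1 v : enorm v <= 1 -> \sum_(j < d) v ord0 j ^+ 2 <= 1.
Proof. by rewrite /enorm -[leRHS]sqrtr1 ler_sqrt. Qed.

(** The derivative is homogeneous of degree [n] in the two components of [v] that matter; these are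
    at most 1 and n >= 2, so their squares dominate, and squares sum over [i] to a bound free of
    [d]. *)
Lemma link_bound sg i x v n : `|sg| = 1 -> enorm v <= 1 -> (1 < n)%N ->
  `|link sg i (nseq n v) x| <=
    (4 * s) ^+ n * (2 * n)`!%:R * (dot (prev i) v ^+ 2 + v ord0 i ^+ 2).
Proof.
move=> sg1 v1 n1.
have vv1 := enorm_le1 v1.
have vi1 : `|v ord0 i| <= 1.
  rewrite -(@expr_le1 _ 2)// real_normK ?num_real//.
  apply: le_trans vv1; rewrite (bigD1 i)//= lerDl.
  by rewrite sumr_ge0// => j _; rewrite sqr_ge0.
have pi1 : `|dot (prev i) v| <= 1.
  rewrite -(@expr_le1 _ 2)// real_normK ?num_real//.
  apply: le_trans (le_trans (sum_dot_prev_sqr v) vv1); rewrite (bigD1 i)//= lerDl.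
  by rewrite sumr_ge0// => j _; rewrite sqr_ge0.
set M := Num.max `|dot (prev i) v| `|v ord0 i|.
have M0 : 0 <= M by rewrite le_max normr_ge0.
have M1 : M <= 1 by rewrite ge_max pi1.
have Mn : M ^+ n <= dot (prev i) v ^+ 2 + v ord0 i ^+ 2.
  apply: (@le_trans _ _ (M ^+ 2)); first by rewrite ler_wiXn2l.
  rewrite /M; case: (leP `|dot (prev i) v| `|v ord0 i|) => _; rewrite real_normK ?num_real//.
    by rewrite lerDr sqr_ge0.
  by rewrite lerDl sqr_ge0.
have sM0 : 0 <= s * M by rewrite mulr_ge0// ltW.
apply: le_trans (dterm_bound _ _ _ _ _ sM0 _) _.
  move=> u; rewrite mem_nseq => /andP[_ /eqP->].
  rewrite !dotZl dot_delta !normrM sg1 mul1r (gtr0_norm s0) !ler_pM2l//.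
  by rewrite !le_max !lexx orbT.
rewrite size_nseq expr0 mul1r !addn0 mulrA exprMn mulrAC.
by rewrite ler_wpM2l// mulr_ge0// exprn_ge0// mulr_ge0// ltW.
Qed.

(** The factor 4: two products for each [i], and two sums of squares, each at most 1. *)
Lemma chain_bound x v n : enorm v <= 1 -> (1 < n)%N ->
  `|chain (nseq n v) x| <= lam * (4 * ((4 * s) ^+ n * (2 * n)`!%:R)).
Proof.
move=> v1 n1; set K := (4 * s) ^+ n * _.
have K0 : 0 <= K by rewrite mulr_ge0// exprn_ge0// mulr_ge0// ltW.
apply: le_trans (ler_norm_sum _ _ _) _.
apply: (@le_trans _ _ (\sum_(i < d) lam * (2 * K) * (dot (prev i) v ^+ 2 + v ord0 i ^+ 2))).
  apply: ler_sum => i _; rewrite normrM -mulrA; apply: ler_pM => //.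
    by rewrite normrM gtr0_norm// ger0_norm// ler_piMr ?(ltW lam0)// lern1 leq_b1.
  apply: le_trans (ler_normB _ _) _; rewrite -mulrA mulr_natl mulr2n lerD//.
    by apply: link_bound; rewrite ?normrN1.
  by apply: link_bound; rewrite ?normr1.
rewrite -mulr_sumr -mulrA ler_pM2l// big_split/=.
have vv1 := enorm_le1 v1.
have := le_trans (sum_dot_prev_sqr v) vv1.
set P := \sum_(i < d) _ ^+ 2; set V := \sum_(i < d) _ in vv1 *; nra.
Qed.

Lemma is_derive_chain vs x v : is_derive x v (chain vs) (chain (v :: vs) x).
Proof.
rewrite (_ : chain vs = \sum_(i < d) (fun z => (lam * (i < T)%:R) *
  (link (-1) i vs z - link 1 i vs z))); last first.
  by apply/funext => z; rewrite fct_sumE.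
apply: is_derive_sum => i; apply: is_deriveZ; apply: is_deriveB;
  exact: is_derive_dterm.
Qed.

Lemma continuous_chain vs : continuous (chain vs).
Proof.
apply: continuous_big => [|i _]; first exact: add_continuous.
apply: continuous_scale => z.
exact: (cvgB (@continuous_dterm _ _ _ _ _ _ _ _ _ z) (@continuous_dterm _ _ _ _ _ _ _ _ _ z)).
Qed.

Lemma pderiv_chain u : pderiv (chain [::]) u =
  chain [seq delta_mx ord0 i | i <- u].
Proof.
elim: u => //= i u ->; apply/funext => x; apply: derive_val.
exact: is_derive_chain.
Qed.

Lemma smooth_chain : smooth (chain [::]).
Proof.
apply/smoothP; split=> [u i x|u]; rewrite pderiv_chain.
  by have [] := is_derive_chain [seq delta_mx ord0 i | i <- u] x (delta_mx ord0 i).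
exact: continuous_chain.
Qed.

Lemma derive1n_chain x v n : ((fun h : R => chain [::] (x + h *: v))^`(n))%classic =
  fun h => chain (nseq n v) (x + h *: v).
Proof.
elim: n => // n IH; rewrite derive1nS IH; apply/funext => h.
rewrite derive1E; apply: derive_val.
by apply: (is_derive_line (f := chain (nseq n v))); exact: is_derive_chain.
Qed.

Lemma lipschitz_chain p : (0 < p)%N ->
  lipschitz_deriv p (lam * (4 * ((4 * s) ^+ p.+1 * (2 * p.+1)`!%:R))) (chain [::]).
Proof.
move=> p0; split; first exact: smooth_chain.
move=> x v v1 t t'; rewrite /= derive1n_chain.
have [h|c _ ->] := @MVT_global R (fun h => chain (nseq p v) (x + h *: v))
  (fun h => chain (nseq p.+1 v) (x + h *: v)) t' t.
  by apply: (is_derive_line (f := chain (nseq p v))); exact: is_derive_chain.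
by rewrite normrM ler_wpM2r// chain_bound.
Qed.

Lemma link0 sg i x : link sg i [::] x =
  flat 0 (sg * (s * dot (prev i) x + (i == 0 :> nat)%:R)) *
  flat 0 (sg * (s * x ord0 i) + 2).
Proof. by rewrite /link/= !dotZl dot_delta -!mulrA -mulrDr. Qed.

Lemma link0_ge0 sg i x : 0 <= link sg i [::] x.
Proof. by rewrite link0 mulr_ge0 ?flat_ge0. Qed.

Lemma link0_le1 sg i x : link sg i [::] x <= 1.
Proof. by rewrite link0 -[1]mulr1 ler_pM ?flat_ge0// (flat_ub 0). Qed.

(** At [0] the positive products vanish, because -y_(i-1) <= 0; everywhere each of the [T] links is
    at least -lam, because psi <= 1. *)
Lemma chain_gap : (T <= d)%N ->
  ((chain [::] 0)%:E - ereal_inf (range (fun x => (chain [::] x)%:E)) <=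
    (lam * T%:R)%:E)%E.
Proof.
move=> Td; have w0 i : 0 <= lam * (i < T)%:R by rewrite mulr_ge0 ?(ltW lam0).
have c0 : chain [::] 0 <= 0.
  apply: sumr_le0 => i _; rewrite mulr_ge0_le0// subr_le0.
  rewrite link0 [X in X * _]flat_le0 ?mul0r ?link0_ge0//.
  by rewrite dotC dot0v mulr0 add0r mulN1r oppr_le0.
have sumT : \sum_(i < d) (i < T)%:R = T%:R :> R.
  rewrite -natr_sum; congr (_%:R).
  transitivity (\sum_(i < T) 1)%N; last by rewrite sum1_card card_ord.
  rewrite (big_ord_widen d (fun=> 1%N) Td) [RHS]big_mkcond.
  by apply: eq_bigr => i _; case: ifP.
have cT : ((- (lam * T%:R))%:E <= ereal_inf (range (fun x => (chain [::] x)%:E)))%E.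
  apply: le_ereal_inf_tmp => _ [x _ <-]; rewrite lee_fin -sumT -mulrN -sumrN mulr_sumr.
  apply: ler_sum => i _; rewrite -mulrA mulrN -mulrN ler_pM2l// -[leLHS]mulrN1.
  rewrite ler_wpM2l//.
  by have := link0_ge0 (-1) i x; have := link0_le1 1 i x; lra.
have c0' : ((chain [::] 0)%:E <= 0%:E)%E by rewrite lee_fin.
apply: le_trans (leeB c0' cT) _.
by rewrite -EFinB sub0r opprK.
Qed.

Lemma coord_le_enorm v i : `|v ord0 i| <= enorm v.
Proof.
rewrite /enorm -sqrtr_sqr ler_wsqrtr// (bigD1 i)//= lerDl.
by rewrite sumr_ge0// => j _; rewrite sqr_ge0.
Qed.

Lemma link1 sg k i x : link sg k [:: delta_mx ord0 i] x =
  sg * s * ((i.+1 == k :> nat)%:R *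
    (flat 2 (sg * (s * dot (prev k) x + (k == 0 :> nat)%:R)) *
     flat 0 (sg * (s * x ord0 k) + 2)) +
  (k == i)%:R *
    (flat 0 (sg * (s * dot (prev k) x + (k == 0 :> nat)%:R)) *
     flat 2 (sg * (s * x ord0 k) + 2))).
Proof.
rewrite /link/= !dotZl !dot_delta !mul0r !subr0 mulrDr !mulrA.
have -> : dot (prev k) (delta_mx ord0 i) = (i.+1 == k :> nat)%:R.
  by rewrite dotC dot_delta mxE.
have -> : (delta_mx ord0 i : 'rV[R]_d) ord0 k = (k == i)%:R by rewrite mxE eqxx.
by rewrite !(mulrDr sg) !mulrA.
Qed.

Lemma flat0_ge (y : R) : 1 <= y -> expR (-1) <= flat 0 y.
Proof.
move=> y1; rewrite /flat (lt_le_trans ltr01 y1) expr0 mul1r ler_expR lerN2.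
by rewrite invf_le1// (lt_le_trans ltr01 y1).
Qed.

Lemma flat2_ge (y : R) : 1 <= y -> y <= 3 -> expR (-1) / 9 <= flat 2 y.
Proof.
move=> y1 y3; have y0 := lt_le_trans ltr01 y1.
rewrite /flat y0 mulrC; apply: ler_pM; rewrite ?invr_ge0 ?expR_ge0//.
  rewrite exprVn lef_pV2 ?posrE ?exprn_gt0// (_ : 9 = 3 ^+ 2); last by rewrite -natrX.
  by rewrite lerXn2r// nnegrE ltW.
by rewrite ler_expR lerN2 invf_le1.
Qed.

(** All terms of all partial derivatives are nonpositive, so a single one bounds the norm from
    below. *)
Lemma chain_grad x : (0 < T <= d)%N ->
  (forall i, i.+1 = T :> nat -> x ord0 i = 0) ->
  lam * s * (expR (-1) * (expR (-1) / 9)) <= enorm (grad (chain [::]) x).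
Proof.
move=> /andP[T0 Td] xT.
have T1d : (T.-1 < d)%N by rewrite prednK.
pose i0 := Ordinal T1d.
have i0P : `|s * x ord0 i0| < 1 by rewrite xT/= ?prednK// mulr0 normr0.
(* The last coordinate, of index T - 1, is 0, so a first index with |y_i| < 1 exists. *)
case: (@arg_minnP _ i0 (fun i => `|s * x ord0 i| < 1) (fun i => i : nat) i0P) => i iP imin.
have iT : (i < T)%N by rewrite (leq_ltn_trans (imin _ i0P))//= prednK.
(* [sg] is the sign of y_(i-1), hence 1 for i = 0; it selects the product whose first factor is away
   from 0. *)
have [sg sg1 sgA] : exists2 sg, sg = 1 \/ sg = -1 &
    1 <= sg * (s * dot (prev i) x + (i == 0 :> nat)%:R).
  have [i0'|[j ji]] := prevP i.
    by exists 1; [left|rewrite dot_prev0// i0' eqxx mulr0 add0r mulr1].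
  have : 1 <= `|s * x ord0 j|.
    rewrite leNgt; apply/negP => /imin; rewrite -ji ltnn//.
  rewrite (dot_prevS _ ji) -ji addr0 ler_normr => /orP[H|H].
    by exists 1; [left|rewrite mul1r].
  by exists (-1); [right|rewrite mulN1r].
have B1 : 1 <= sg * (s * x ord0 i) + 2 /\ sg * (s * x ord0 i) + 2 <= 3.
  by move: iP; rewrite ltr_norml => /andP[]; case: sg1 => ->; split; lra.
have G : expR (-1) * (expR (-1) / 9) <=
    flat 0 (sg * (s * dot (prev i) x + (i == 0 :> nat)%:R)) *
    flat 2 (sg * (s * x ord0 i) + 2).
  apply: ler_pM; rewrite ?divr_ge0 ?expR_ge0//; first exact: flat0_ge.
  by apply: flat2_ge; case: B1.
apply: le_trans (coord_le_enorm _ i); rewrite mxE pderiv_chain/= -normrN.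
apply: le_trans (ler_norm _); rewrite /chain -sumrN.
pose P sg k : R := (i.+1 == k :> nat)%:R *
    (flat 2 (sg * (s * dot (prev k) x + (k == 0 :> nat)%:R)) *
     flat 0 (sg * (s * x ord0 k) + 2)) +
  (k == i)%:R *
    (flat 0 (sg * (s * dot (prev k) x + (k == 0 :> nat)%:R)) *
     flat 2 (sg * (s * x ord0 k) + 2)).
have P0 sg' k : 0 <= P sg' k by rewrite addr_ge0// !mulr_ge0 ?flat_ge0.
rewrite (eq_bigr (fun k : 'I_d => lam * s * ((k < T)%:R * (P (-1) k + P 1 k)))); last first.
  by move=> k _; rewrite !link1 -/(P _ _) -/(P _ _); ring.
rewrite -mulr_sumr ler_pM2l ?mulr_gt0// (bigD1 i)//= iT mul1r.
apply: (@le_trans _ _ (P sg i)).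
  by rewrite /P (gtn_eqF (ltnSn i)) eqxx mul0r add0r mul1r.
rewrite -[leLHS]addr0 lerD//; last first.
  by apply: sumr_ge0 => k _; rewrite mulr_ge0// addr_ge0.
by case: sg1 => ->; rewrite ?lerDl ?lerDr.
Qed.

(** Coordinate [k] enters only links k and k + 1, whose first factors read the coordinates k - 1 >=
    m and k and so are flat there. Coordinate [m] escapes: link m reads coordinate m - 1, which may
    be nonzero. *)
Lemma chain_vanish m x k vs : (forall j, (m <= j)%N -> x ord0 j = 0) ->
  (m < k)%N -> chain (delta_mx ord0 k :: vs) x = 0.
Proof.
move=> xm mk; apply: big1 => i _.
suff L sg : link sg i (delta_mx ord0 k :: vs) x = 0 by rewrite !L subrr mulr0.
have [ki|ki] := boolP ((k == i) || (k.+1 == i :> nat)); last first.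
  move: ki; rewrite negb_or => /andP[k1 k2].
  apply: dterm_indep; rewrite dotZl.
    by rewrite dotC dot_delta mxE (negbTE k2) mulr0.
  by rewrite dot_delta mxE eqxx eq_sym (negbTE k1) mulr0.
have mi : (m < i)%N.
  by case/orP: ki => /eqP <-//; rewrite ltnS ltnW.
apply: dterm_flat; have [i0|[j ji]] := prevP i; first by rewrite i0 in mi.
rewrite dotZl (dot_prevS _ ji) xm; last by rewrite -ltnS ji.
by rewrite -ji !mulr0 addr0.
Qed.

Lemma zero_respecting_chain (x : nat -> 'rV[R]_d) :
  zero_respecting (chain [::]) x ->
  forall t j, (t <= j)%N -> x t ord0 j = 0.
Proof.
move=> zr; elim/ltn_ind => t IH j tj; apply: contrapT => xtj.
have [q _ [m /= mt H]] := zr t j xtj; apply: H; apply/funext => u.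
rewrite /slice/nabla pderiv_chain/=; apply: (@chain_vanish m).
  by move=> l ml; exact: IH.
exact: leq_trans mt tj.
Qed.

End chain.

(** * The lower bound *)

Section constants.
Context {R : realType}.

(* The gradient of the unscaled chain has a component at least
   [flat 0 1 * inf (flat 2) >= expR (-1) * (expR (-1) / 9)], the infimum being
   over [[1, 3]]. *)
Definition grad_const : R := expR (-1) * (expR (-1) / 9).

(** The Lipschitz constant of the chain with s = 1 and amplitude 2 / [grad_const], for which the
    gradient bound is 2. *)
Definition ell (p : nat) : R :=
  2 / grad_const * (4 * (4 ^+ p.+1 * (2 * p.+1)`!%:R)).

Lemma grad_const_gt0 : 0 < grad_const.
Proof. by rewrite mulr_gt0 ?divr_gt0 ?expR_gt0. Qed.

Lemma grad_const_le1 : grad_const <= 1.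
Proof.
have e1 : expR (-1) <= 1 :> R by rewrite expR_le1 lerN10.
by rewrite mulr_ile1 ?divr_ge0 ?expR_ge0// ler_pdivrMr// mul1r (le_trans e1)// ler1n.
Qed.

Lemma ell_gt0 p : 0 < ell p.
Proof.
rewrite mulr_gt0 ?divr_gt0 ?grad_const_gt0// !mulr_gt0 ?exprn_gt0//.
Qed.

Lemma fact_le_expn n : (n`! <= n ^ n)%N.
Proof.
elim: n => // n IH; rewrite factS expnS leq_mul2l/=.
by case: n IH => // n IH; apply: leq_trans IH _; rewrite leq_exp2r.
Qed.

Lemma fact_double_le p : (0 < p)%N ->
  ((2 * p.+1)`! <= 4 ^ (5 * p) * p ^ (2 * p))%N.
Proof.
move=> p0; apply: leq_trans (fact_le_expn _) _.
(* The surplus p^2 in (4 p)^(2 p + 2) is absorbed by 4^p = (2^p)^2. *)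
have p2 : (p <= 2 ^ p)%N by rewrite ltnW// ltn_expl.
apply: (@leq_trans ((4 * p) ^ (2 * p.+1))); first by rewrite leq_exp2r//; lia.
rewrite expnMn mulnS (expnD p) mulnA [leqRHS]mulnC [leqRHS]mulnC leq_mul2r.
apply/orP; right.
have -> : (5 * p = 4 * p + p)%N by lia.
rewrite (expnD 4 (4 * p) p) leq_mul//; first by rewrite leq_exp2l//; lia.
have -> : (4 ^ p = (2 ^ p) ^ 2)%N by rewrite -expnM mulnC expnM.
by rewrite leq_exp2r.
Qed.

(** The constant c_1. The exponent 8 comes from the powers of 4 in the bound on [ell p], where p + 2
    + 5 p <= 8 p. *)
Definition ell_rate : R := ln (2 / grad_const * 4 ^+ 8).

Lemma ell_base_gt1 : 1 < 2 / grad_const * 4 ^+ 8.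
Proof.
have c0 := grad_const_gt0; have c1 := grad_const_le1.
apply: (@lt_le_trans _ _ (2 / grad_const)).
  by rewrite ltr_pdivlMr// mul1r (le_lt_trans c1)// ltr1n.
by rewrite ler_peMr ?divr_ge0 ?(ltW c0)// exprn_ege1// ler1n.
Qed.

Lemma ell_rate_gt0 : 0 < ell_rate.
Proof. by rewrite ln_gt0// ell_base_gt1. Qed.

Lemma ell_le p : (1 <= p)%N ->
  ell p <= expR (5 / 2 * p%:R * ln p%:R + ell_rate * p%:R).
Proof.
move=> p1; have c0 := grad_const_gt0; set K := 2 / grad_const.
have K1 : 1 <= K.
  rewrite ler_pdivlMr// mul1r (le_trans grad_const_le1)// ler1n//.
have K0 : 0 <= K by apply: le_trans K1.
have pp0 : 0 < p%:R :> R by rewrite ltr0n.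
rewrite expRD expRM_natr lnK; last by rewrite posrE (lt_trans ltr01 ell_base_gt1).
(* Up to an exponential the factorial grows like p^(2p), and 2 <= 5/2. *)
apply: (@le_trans _ _ (p%:R ^+ (2 * p) * (K * 4 ^+ 8) ^+ p)); last first.
  have M0 : 0 <= (K * 4 ^+ 8) ^+ p by rewrite exprn_ge0// mulr_ge0// exprn_ge0.
  rewrite ler_wpM2r//.
  rewrite -[X in X ^+ _](@lnK R) ?posrE// -expRM_natl ler_expR natrM.
  rewrite ler_wpM2r ?ln_ge0 ?ler1n// ler_wpM2r//; lra.
rewrite /ell -/K; apply: (@le_trans _ _ (K * (4 * (4 ^+ p.+1 * (4 ^ (5 * p) * p ^ (2 * p))%:R)))).
  by rewrite !ler_wpM2l ?exprn_ge0// ler_nat fact_double_le.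
rewrite natrM !natrX mulrC.
have -> : 4 * (4 ^+ p.+1 * (4 ^+ (5 * p) * p%:R ^+ (2 * p))) * K =
   p%:R ^+ (2 * p) * (K * (4 ^+ (p.+2 + 5 * p))) :> R.
  by rewrite exprD !exprS; ring.
rewrite ler_wpM2l ?exprn_ge0// exprMn -exprM ler_pM ?exprn_ge0//.
  by rewrite -[leLHS]expr1 ler_weXn2l.
by rewrite ler_weXn2l ?ler1n//; lia.
Qed.

End constants.

(** * Choice of scale, amplitude and length *)

Section scaling.
Context {R : realType}.
Variables (p : nat) (Delta L eps : R).
Hypotheses (p0 : (1 <= p)%N) (Delta0 : 0 < Delta) (L0 : 0 < L) (eps0 : 0 < eps).

Let c : R := grad_const.
(** [s] and [lam] solve lam s c = 2 eps, a gradient bound with room for strictness, and eps (ell p)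
    s^p = L, the Lipschitz constraint. The factor c / 2 in [B] then gives lam B = Delta. *)
Let s : R := (L / (ell p * eps)) `^ p%:R^-1.
Let lam : R := 2 * eps / (c * s).
Let B : R := lower_bound (c / 2) (ell p) p Delta L eps.
(** As many links as the gap [Delta] pays for. The first [T] iterates fail, and T + 1 exceeds
    [B]. *)
Let T := Num.truncn B.

Let c_gt0 : 0 < c. Proof. exact: grad_const_gt0. Qed.

Let s_gt0 : 0 < s.
Proof. by rewrite powR_gt0// divr_gt0// mulr_gt0// ell_gt0. Qed.

Let lam_gt0 : 0 < lam.
Proof. by rewrite divr_gt0 ?mulr_gt0. Qed.

Lemma lower_boundE : B = c / 2 * Delta * (s / eps).
Proof.
have pn0 : p%:R != 0 :> R by rewrite pnatr_eq0 -lt0n.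
rewrite /B /lower_bound -mulrA; congr (_ * _).
have -> : s = (L / ell p) `^ p%:R^-1 * eps^-1 `^ p%:R^-1.
  by rewrite -powRM ?invr_ge0 ?(ltW eps0) ?divr_ge0 ?(ltW L0) ?(ltW (ell_gt0 _))// /s invfM mulrA.
rewrite -mulrA; congr (_ * _).
have -> : - ((1 + p%:R) / p%:R) = - p%:R^-1 + -1 :> R by field.
rewrite powRD ?(gt_eqF eps0) ?implybT// powR_inv1 ?(ltW eps0)//.
rewrite powRN; congr (_ * _).
by rewrite -(powR_inv1 (ltW eps0)) -powRrM mulN1r powRN.
Qed.

Lemma lamB : lam * B = Delta.
Proof.
rewrite lower_boundE /lam; field.
by rewrite !gt_eqF.
Qed.

Lemma B_ge0 : 0 <= B.
Proof. by rewrite lower_boundE ltW// !mulr_gt0// ?divr_gt0// invr_gt0. Qed.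

Lemma T_le_B : T%:R <= B.
Proof. by rewrite truncn_le B_ge0. Qed.

Lemma B_lt_T : B < T.+1%:R.
Proof. exact: truncnS_gt. Qed.

Lemma s_pow : s ^+ p = L / (ell p * eps).
Proof.
rewrite /s -powR_mulrn ?powR_ge0// -powRrM mulVf ?powRr1//.
  by rewrite ltW// divr_gt0// mulr_gt0// ell_gt0.
by rewrite pnatr_eq0 -lt0n.
Qed.

Lemma Fclass_chain d : (T <= d)%N -> (0 < d)%N ->
  Fclass p Delta L (@chain R d T lam s [::]).
Proof.
move=> Td d0; split=> //; first exact: smooth_chain.
  have := lipschitz_chain (d := d) T lam_gt0 s_gt0 p0.
  rewrite (_ : lam * _ = L)//.
  rewrite (_ : 4 * _ = c / 2 * ell p * s ^+ p.+1); last first.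
    by rewrite exprMn /ell -/c; field; rewrite gt_eqF.
  rewrite exprS s_pow /lam; field.
  by rewrite !gt_eqF// ell_gt0.
apply: le_trans (@chain_gap R d T lam s lam_gt0 Td) _.
by rewrite lee_fin -lamB ler_pM2l// T_le_B.
Qed.

Lemma chain_zr_grad d (x : nat -> 'rV[R]_d) t : (T <= d)%N -> (t < T)%N ->
  zero_respecting (@chain R d T lam s [::]) x ->
  eps < enorm (grad (@chain R d T lam s [::]) (x t)).
Proof.
move=> Td tT zr; have xt := zero_respecting_chain zr.
apply: lt_le_trans (chain_grad lam_gt0 s_gt0 _ _); last first.
- by move=> i iT; apply: xt; rewrite -ltnS iT.
- by rewrite Td andbT (leq_ltn_trans _ tT).
rewrite -/grad_const -/c (_ : lam * s * c = 2 * eps); first by rewrite ltr_pMl// ltr1n.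
by rewrite /lam; field; rewrite !gt_eqF.
Qed.

Local Open Scope ereal_scope.

(** [G] is left general to serve for both the full and the restricted class. *)
Lemma le_complexity_zr d (G : fclass R) : (T <= d)%N ->
  G d (@chain R d T lam s [::]) -> B%:E <= complexity eps (@A_zr R) G.
Proof.
move=> Td Gf; apply: le_ereal_inf_tmp => _ [A [_ Azr] <-].
apply: (@le_trans _ _ (T.+1%:R)%:E); first by rewrite lee_fin ltW// B_lt_T.
apply: le_trans (@alg_time_ge R A eps d (@chain R d T lam s [::]) T _) _.
  move=> xi t xi01 tT.
  apply: (chain_zr_grad (x := fun t => iterate A _ t xi)) => //.
  by apply: Azr => //; exact: smooth_chain.
by apply: ereal_sup_ubound; exists d, (@chain R d T lam s [::]).
Qed.

Lemma le_complexity_det d : (2 * T < d)%N ->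
  B%:E <= complexity eps (@A_det R) (restrict_dim (Fclass p Delta L) d).
Proof.
move=> Td; apply: le_ereal_inf_tmp => _ [A Adet <-].
apply: (@le_trans _ _ (T.+1%:R)%:E); first by rewrite lee_fin ltW// B_lt_T.
(* [T.+1] variables, as [T] may be 0 and dimensions are positive; with [T] queries this needs 2 T +
   1 <= d. *)
pose f := @chain R T.+1 T lam s [::].
have sf : smooth f by exact: smooth_chain.
have Ff : Fclass p Delta L f by exact: Fclass_chain.
have nT : (T.+1 + T <= d)%N by rewrite addSn addnn -mul2n.
have [W WW HW] := @resisting_det R A (fun=> d) T.+1 T f Adet sf nT.
apply: le_trans (@alg_time_ge R A eps d (fun y => f (y *m W^T)) T _) _.
  move=> xi t xi01 tT; rewrite (grad_mulmx W _ sf) (enorm_mulmx WW).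
  rewrite (HW t xi xi tT xi01).
  apply: (chain_zr_grad (x := fun t => iterate (resisting_alg A (fun=> d)) f t xi)) => //.
  by have [_] := resisting_zr A (fun=> d); exact.
have FW : Fclass p Delta L (fun y => f (y *m W^T)).
  exact: (Fclass_mulmx WW (leq_ltn_trans (leq0n _) Td) Ff).
by apply: ereal_sup_ubound; exists d, (fun y => f (y *m W^T)).
Qed.

Lemma lower_bound_dim : (2 * T < `|Num.ceil (1 + 2%:R * B)%R|)%N.
Proof.
rewrite -(ltr_nat R) natr_absz.
have cB : (1 + 2 * B <= (Num.ceil (1 + 2%:R * B))%:~R)%R by exact: ceil_ge.
have := B_ge0; have := T_le_B => TB B0.
rewrite ger0_norm; last first.
  by rewrite -(ler_int R) (le_trans _ cB)//; lra.
by rewrite natrM; lra.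
Qed.

End scaling.

Unset Implicit Arguments.

Theorem theorem1 (R : realType) :
  exists (c0 c1 : R) (ell : nat -> R),
    [/\ 0 < c0,
        0 < c1,
        forall p : nat, (1 <= p)%N ->
          0 < ell p <= expR (5%:R / 2%:R * p%:R * ln (p%:R : R) + c1 * p%:R) &
        forall (p : nat) (Delta L eps : R),
          (1 <= p)%N -> 0 < Delta -> 0 < L -> 0 < eps ->
          let F := Fclass p Delta L in
          let B := lower_bound c0 (ell p) p Delta L eps in
          let Fd := restrict_dim F `|Num.ceil (1 + 2%:R * B)|%N in
          [/\ (complexity eps (@A_zr R) F <= complexity eps (@A_det R) F)%E,
              (B%:E <= complexity eps (@A_zr R) F)%E,
              (B%:E <= complexity eps (@A_zr R) Fd)%E &
              (B%:E <= complexity eps (@A_det R) Fd)%E]].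
Proof.
exists (grad_const / 2), ell_rate, ell; split.
- by rewrite divr_gt0// grad_const_gt0.
- exact: ell_rate_gt0.
- by move=> p p1; rewrite ell_gt0 ell_le.
move=> p Delta L eps p1 Delta0 L0 eps0 F B Fd.
have dB := lower_bound_dim p1 Delta0 L0 eps0.
have Td := leq_trans (leq_pmull _ (isT : 0 < 2)%N) (ltnW dB).
have FT := Fclass_chain p1 Delta0 L0 eps0 Td (leq_ltn_trans (leq0n _) dB).
split.
- exact: complexity_zr_le_det.
- exact: le_complexity_zr Td FT.
- exact: (le_complexity_zr (G := Fd) L0 eps0 Td (conj erefl FT)).
- exact: le_complexity_det.
Qed.
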